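(* Let $\mathcal{A}:f=0$ be a nearly supersolvable line arrangement of $d$ lines in the complex projective plane $\mathbb{P}^2$, and let $p$ be a nearly modular point of $\mathcal{A}$, of multiplicity $m_p(\mathcal{A})$. Then either $mdr(f)=d-m_p(\mathcal{A})$ and then $\mathcal{A}$ is nearly free, or $d=2d_1+1$, $mdr(f)=m_p(\mathcal{A})=d_1$ and then $\mathcal{A}$ is free. In fact, the first case occurs when $2m_p(\mathcal{A})\ge d$, while the second case occurs when $2m_p(\mathcal{A})=d-1$.
   Context: A line arrangement $\mathcal{A}:f=0$ of $d$ lines is a finite set of $d$ distinct lines in $\mathbb{P}^2=\mathbb{P}^2(\mathbb{C})$, where $f\in S=\mathbb{C}[x,y,z]$ is the product of $d$ linear forms defining the lines. An intersection point (or multiple point) of $\mathcal{A}$ is a point lying on at least two lines of $\mathcal{A}$; its multiplicity $m_p(\mathcal{A})$ is the number of lines of $\mathcal{A}$ through it; a double point has multiplicity $2$. An intersection point $p$ is modular if for any other intersection point $q$ of $\mathcal{A}$ the line $\overline{pq}$ belongs to $\mathcal{A}$. $\mathcal{A}$ is supersolvable if it has a modular intersection point. An intersection point $p$ is nearly modular if: (1) for any intersection point $q\ne p$ of $\mathcal{A}$, with the exception of a unique double point $p'\neq p$ of $\mathcal{A}$, the line $\overline{pq}$ belongs to $\mathcal{A}$; (2) the line $L=\overline{pp'}$ is not in $\mathcal{A}$ and contains only two multiple points of $\mathcal{A}$, namely $p$ and $p'$. $\mathcal{A}$ is nearly supersolvable if it is not supersolvable but has a nearly modular intersection point. $AR(f)\subset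 S^3$ is the graded $S$-module whose degree $m$ component consists of the triples $(a,b,c)\in S_m^3$ with $af_x+bf_y+cf_z=0$, where $f_x,f_y,f_z$ are the partial derivatives. $mdr(f)$ is the smallest $m\ge0$ with $AR(f)_m\neq0$. $\mathcal{A}$ is free if $AR(f)$ is a free graded $S$-module. Let $\tau(\mathcal{A})=\sum_{k\ge2}n_k(k-1)^2$ be the global Tjurina number, where $n_k$ is the number of intersection points of multiplicity $k$. With $r=mdr(f)$, $\mathcal{A}$ is nearly free if $\tau(\mathcal{A})=(d-1)^2-r(d-r-1)-1$. *)

(* Defs.v *)
From HB Require Import structures.
From mathcomp Require Import all_boot all_order all_algebra.
From mathcomp Require Import finmap mpoly complex boolp reals.

Set Implicit Arguments.
Unset Strict Implicit.
Unset Printing Implicit Defensive.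

Import Order.TTheory GRing.Theory Num.Theory.

Local Open Scope ring_scope.
Local Open Scope fset_scope.

(* Points and lines of P^2 are the subspaces of dimension 1 and 2 of F^3;      *)
(* incidence is inclusion, the line through two distinct points is their sum,  *)
(* and the common point of two distinct lines is their intersection.           *)
Notation subsp F := {vspace 'rV[F]_3} (only parsing).

Definition is_point (F : fieldType) (p : subsp F) : bool := \dim p == 1%N.

Definition is_line (F : fieldType) (L : subsp F) : bool := \dim L == 2%N.

Definition line_arrangement (F : fieldType) (A : {fset subsp F}) : Prop :=
  forall L, L \in A -> is_line L.

Definition defines_line (F : fieldType) (l : {mpoly F[3]}) (L : subsp F) : Prop :=
  l \is 1.-homog /\ forall v : 'rV[F]_3, v \in L <-> l.@[fun i => v ord0 i] = 0.

Definition defining_equation (F : fieldType) (A : {fset subsp F})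
    (f : {mpoly F[3]}) : Prop :=
  exists2 l : subsp F -> {mpoly F[3]},
    forall L, L \in A -> defines_line (l L) L & f = \prod_(L <- A) l L.

Definition multiplicity (F : fieldType) (A : {fset subsp F}) (p : subsp F) : nat :=
  #|` [fset L in A | (p <= L)%VS]|.

Definition intersection_point (F : fieldType) (A : {fset subsp F})
    (p : subsp F) : bool :=
  is_point p && (2 <= multiplicity A p)%N.

Definition modular (F : fieldType) (A : {fset subsp F}) (p : subsp F) : Prop :=
  intersection_point A p /\
  forall q, intersection_point A q -> q <> p -> (p + q)%VS \in A.

Definition supersolvable (F : fieldType) (A : {fset subsp F}) : Prop :=
  exists p, modular A p.

Definition nearly_modular (F : fieldType) (A : {fset subsp F}) (p : subsp F) : Prop :=
  intersection_point A p /\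
  exists p', [/\ intersection_point A p', multiplicity A p' = 2%N & p' <> p] /\
    [/\ forall q, intersection_point A q -> q <> p -> q <> p' -> (p + q)%VS \in A,
        (p + p')%VS \notin A &
        forall q, intersection_point A q -> (q <= p + p')%VS -> q = p \/ q = p'].

Definition nearly_supersolvable (F : fieldType) (A : {fset subsp F}) : Prop :=
  ~ supersolvable A /\ exists p, nearly_modular A p.

(* The finite set of all intersection points: see [in_intersection_points].    *)
Definition intersection_points (F : fieldType) (A : {fset subsp F}) : {fset subsp F} :=
  [fset p in [fset (L :&: M)%VS | L in A, M in A] | intersection_point A p].

Definition num_points (F : fieldType) (A : {fset subsp F}) (k : nat) : nat :=
  #|` [fset p in intersection_points A | multiplicity A p == k]|.

(* A point lies on at most #|` A| lines, so the terms with k > #|` A| vanish.  *)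
Definition tjurina (F : fieldType) (A : {fset subsp F}) : nat :=
  (\sum_(2 <= k < #|` A|.+1) num_points A k * (k - 1) ^ 2)%N.

(* A triple (a, b, c) of polynomials is a row vector.                          *)
Definition syzygy (F : fieldType) (f : {mpoly F[3]}) (v : 'rV[{mpoly F[3]}]_3) : Prop :=
  \sum_(i < 3) v ord0 i * f^`M(i) = 0.

Definition AR (F : fieldType) (f : {mpoly F[3]}) (m : nat)
    (v : 'rV[{mpoly F[3]}]_3) : Prop :=
  (forall i, v ord0 i \is m.-homog) /\ syzygy f v.

Definition AR_nonzero (F : fieldType) (f : {mpoly F[3]}) (m : nat) : Prop :=
  exists2 v, AR f m v & v <> 0.

(* The default value 0 is irrelevant for homogeneous f: see [mdrP].            *)
Definition mdr (F : fieldType) (f : {mpoly F[3]}) : nat :=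
  match pselect (exists m, `[< AR_nonzero f m >]) with
  | left ex => ex_minn ex
  | right _ => 0%N
  end.

(* AR(f) has a basis of homogeneous elements, the rows of E.  It is a          *)
(* submodule of S^3, so each of its bases is finite.                           *)
Definition free_arrangement (F : fieldType) (f : {mpoly F[3]}) : Prop :=
  exists (n : nat) (E : 'M[{mpoly F[3]}]_(n, 3)) (e : 'I_n -> nat),
    (forall i, AR f (e i) (row i E)) /\
    forall v, syzygy f v -> exists! c : 'rV[{mpoly F[3]}]_n, v = c *m E.

Definition nearly_free (F : fieldType) (A : {fset subsp F}) (f : {mpoly F[3]}) : Prop :=
  let d := (#|` A|)%:Z in let r := (mdr f)%:Z in
  (tjurina A)%:Z = (d - 1) ^+ 2 - r * (d - r - 1) - 1.

Lemma in_intersection_points (F : fieldType) (A : {fset subsp F}) (p : subsp F) :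
  line_arrangement A -> (p \in intersection_points A) = intersection_point A p.
Proof.
move=> lA; rewrite !inE /=; apply/andb_idl => /andP[/eqP dp mp].
have [L LP] : exists L, L \in [fset L in A | (p <= L)%VS].
  by apply/fset0Pn; rewrite -cardfs_gt0 ltnW.
move: (mp); rewrite /multiplicity (cardfsD1 L) LP ltnS => /=.
rewrite cardfs_gt0 => /fset0Pn[M]; rewrite !inE /= => /and3P[nML MA pM].
move: LP; rewrite !inE /= => /andP[LA pL].
apply/imfset2P; exists L => //; exists M => //.
apply/eqP; rewrite eqEdim subv_cap pL pM dp /=.
have dL := eqP (lA _ LA); have dM := eqP (lA _ MA).
rewrite leqNgt; apply/negP => d2; case/negP: nML.
have eL : (L :&: M)%VS = L by apply/eqP; rewrite eqEdim capvSl dL.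
have eM : (L :&: M)%VS = M by apply/eqP; rewrite eqEdim capvSr dM.
by rewrite -eM eL.
Qed.

Lemma mderiv_homog (F : fieldType) (f : {mpoly F[3]}) (d : nat) (i : 'I_3) :
  f \is d.-homog -> f^`M(i) \is d.-1.-homog.
Proof.
move=> hf; apply/dhomogP => m; rewrite mcoeff_msupp mcoeff_mderiv => cm.
have /(dhomog_mf hf) : (m + U_(i))%MM \in msupp f.
  by rewrite mcoeff_msupp; apply: contraNneq cm => ->; rewrite mul0rn.
by rewrite /= mdegD mdeg1 addn1 => <-.
Qed.

Lemma AR_nonzero_ex (F : fieldType) (f : {mpoly F[3]}) (d : nat) :
  f \is d.-homog -> exists m, AR_nonzero f m.
Proof.
move=> hf; pose i0 : 'I_3 := ord0; pose i1 : 'I_3 := lift ord0 ord0.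
have [f0|f0] := eqVneq f^`M(i0) 0.
- exists 0%N, (delta_mx ord0 i0); last first.
    by move/matrixP/(_ ord0 i0)/eqP; rewrite !mxE eqxx oner_eq0.
  split=> [i|]; first by rewrite mxE; case: (_ && _); rewrite ?dhomog1 ?dhomog0.
  rewrite /syzygy (bigD1 i0) //= f0 mulr0 add0r big1 // => i ni.
  by rewrite mxE (negbTE ni) andbF mul0r.
exists d.-1, (f^`M(i1) *: delta_mx ord0 i0 - f^`M(i0) *: delta_mx ord0 i1); last first.
  move/matrixP/(_ ord0 i1)/eqP; rewrite !mxE !eqxx /= mulr0 mulr1 sub0r oppr_eq0.
  exact/negP.
split=> [i|].
  rewrite !mxE eqxx /=; case: (i == i0); case: (i == i1);
  by rewrite ?mulr0 ?mulr1 ?subr0 ?sub0r ?rpredB ?rpredN ?dhomog0 ?mderiv_homog.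
rewrite /syzygy (bigD1 i0) //= (bigD1 i1) //= big1 => [|i /andP[n0 n1]].
  by rewrite !mxE !eqxx /= !mulr0 !mulr1 subr0 sub0r addr0 mulNr mulrC subrr.
by rewrite !mxE (negbTE n0) (negbTE n1) !andbF !mulr0 subr0 mul0r.
Qed.

Lemma mdrP (F : fieldType) (f : {mpoly F[3]}) (d : nat) : f \is d.-homog ->
  AR_nonzero f (mdr f) /\ forall m, AR_nonzero f m -> (mdr f <= m)%N.
Proof.
move=> /AR_nonzero_ex[m fm]; rewrite /mdr; case: pselect => [ex|]; last first.
  by case; exists m; apply/asboolP.
case: ex_minnP => r /asboolP fr minr; split=> // k fk.
by apply: minr; apply/asboolP.
Qed.

(* Main.v *)
(* Let p' be the exceptional double point, L the line pp', g and h the products *)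
(* of the linear forms of the m lines through p and of the e = d - m others,    *)
(* and E the Euler field.  A syzygy v of degree r < m tangent to all lines      *)
(* satisfies det(E, v, p) = c g with c constant; since v(p') is proportional to *)
(* p', evaluating at p' gives c = 0, so that v = b E + c' p with h dividing c', *)
(* hence r >= e.  As h p yields a syzygy of degree e, mdr(f) = e when e <= m.   *)
(* Adding L makes p a modular point, so there is a field t of degree m tangent  *)
(* to L and to all lines, with det(E, t, p) a nonzero multiple of g L.  Modulo  *)
(* L, t = b E + C p, where C, of degree m, vanishes on the e - 1 points of L    *)
(* other than p that lie on lines of h.  If C = 0 modulo L, dividing by L gives *)
(* a field of degree m - 1 which the evaluation at p' excludes; so e <= m + 1.  *)
(* If e = m + 1, subtracting from t multiples of E and p, dividing by L and     *)
(* multiplying by one of the lines through p' gives a second field of degree m, *)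
(* and f is free by Saito's criterion.  Near freeness for e <= m then follows   *)
(* from tau(A) = (m - 1)^2 + e (d - 1) - 1, obtained by counting the triples    *)
(* (q, H, K) of a point and two lines of h through it.                          *)

From HB Require Import structures.
Require Import Defs.
From mathcomp Require Import all_boot all_order all_algebra.
From mathcomp Require Import finmap mpoly complex boolp reals.
From mathcomp Require Import ring zify.

Set Implicit Arguments.
Unset Strict Implicit.
Unset Printing Implicit Defensive.

Import Order.TTheory GRing.Theory Num.Theory.

Local Open Scope ring_scope.

(** * Vectors in three-space *)

(** A triple of polynomials is read as a vector field on three-space. Up to multiples of the Euler
    field E, the syzygies of f are the fields tangent to every line ([tangent_AR], [AR_tangent]).
    Let m be the multiplicity of p and e = d - m, and let g and h be the products of the forms of
    the lines through p and off p.

    For a tangent field v, det(E, v, p) is divisible by g, and it vanishes at p' because v(p') is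
    proportional to p' there. In degree below m this forces det(E, v, p) = 0, so v lies in the plane
    of E and p, and then h divides the coefficient of p. Hence mdr(f) is at least m or at least e
    ([AR_degree]), while h p shows that it is at most e ([AR_upper]).

    The bound e <= m + 1 comes from the line L = pp'. Adding L makes p modular, so [modular_field]
    supplies a field of degree m, and [plane_field] and [plane_quotient] compare it modulo L with
    the plane of E and p ([size_hs_le]). In the extreme case e = m + 1 the same comparison yields a
    second field of degree m, and [Saito] gives freeness ([balanced_free]). When e <= m, mdr(f) = e
    and near freeness is a numerical identity, obtained from the count [tjurina_near]. The ranges e
    <= m and e = m + 1 are d <= 2m and d = 2m + 1; they are exhaustive and disjoint, which gives the
    equivalences. *)

HB.lock Definition dot (R : comNzRingType) (u v : 'rV[R]_3) : R :=
  \sum_(i < 3) u ord0 i * v ord0 i.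

(* The indices are taken modulo 3. *)
Definition cross (R : comNzRingType) (u v : 'rV[R]_3) : 'rV[R]_3 :=
  \row_(i < 3) (u ord0 (i + 1) * v ord0 (i + 2%:R)
              - u ord0 (i + 2%:R) * v ord0 (i + 1)).

Definition det3 (R : comNzRingType) (u v w : 'rV[R]_3) : R := dot u (cross v w).

Lemma ord3_addE : (((0 + 1 = 1 :> 'I_3)%R * (0 + 2%:R = 2%:R :> 'I_3)%R) *
  ((1 + 1 = 2%:R :> 'I_3)%R * (1 + 2%:R = 0 :> 'I_3)%R) *
  ((2%:R + 1 = 0 :> 'I_3)%R * (2%:R + 2%:R = 1 :> 'I_3)%R))%type.
Proof. by do !split; apply: val_inj. Qed.

Section Vectors.

Variable R : comNzRingType.
Implicit Types (u v w a b n : 'rV[R]_3) (c x y z k l : R).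

Lemma forall_ord3 (P : 'I_3 -> Prop) : P 0 -> P 1 -> P 2%:R -> forall i, P i.
Proof.
move=> P0 P1 P2 [[|[|[|//]]] lti]; [move: P0|move: P1|move: P2];
  by congr P; apply: val_inj.
Qed.

Lemma dotE u v :
  dot u v = u ord0 0 * v ord0 0 + u ord0 1 * v ord0 1 + u ord0 2%:R * v ord0 2%:R.
Proof.
rewrite dot.unlock !big_ord_recl big_ord0 addr0 addrA.
by congr (u _ _ * v _ _ + u _ _ * v _ _ + u _ _ * v _ _); apply: val_inj.
Qed.

Lemma cross0E u v :
  cross u v ord0 0 = u ord0 1 * v ord0 2%:R - u ord0 2%:R * v ord0 1.
Proof. by rewrite mxE !ord3_addE. Qed.

Lemma cross1E u v :
  cross u v ord0 1 = u ord0 2%:R * v ord0 0 - u ord0 0 * v ord0 2%:R.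
Proof. by rewrite mxE !ord3_addE. Qed.

Lemma cross2E u v :
  cross u v ord0 2%:R = u ord0 0 * v ord0 1 - u ord0 1 * v ord0 0.
Proof. by rewrite mxE !ord3_addE. Qed.

Definition crossE := (cross0E, cross1E, cross2E).

Lemma rowP3 u v : u ord0 0 = v ord0 0 -> u ord0 1 = v ord0 1 ->
  u ord0 2%:R = v ord0 2%:R -> u = v.
Proof. by move=> ? ? ?; apply/rowP; apply: forall_ord3. Qed.

Lemma entryD u v i : (u + v) ord0 i = u ord0 i + v ord0 i.
Proof. by rewrite mxE. Qed.

Lemma entryB u v i : (u - v) ord0 i = u ord0 i - v ord0 i.
Proof. by rewrite !mxE. Qed.

Lemma entryZ c u i : (c *: u) ord0 i = c * u ord0 i.
Proof. by rewrite mxE. Qed.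

Lemma dotC u v : dot u v = dot v u.
Proof. by rewrite !dotE; ring. Qed.

Lemma dotDr u v w : dot u (v + w) = dot u v + dot u w.
Proof. by rewrite !dotE !mxE; ring. Qed.

Lemma dotZr c u v : dot u (c *: v) = c * dot u v.
Proof. by rewrite !dotE !mxE; ring. Qed.

Lemma dotNr u v : dot u (- v) = - dot u v.
Proof. by rewrite !dotE !mxE; ring. Qed.

Lemma dotBr u v w : dot u (v - w) = dot u v - dot u w.
Proof. by rewrite dotDr dotNr. Qed.

Lemma dotDl u v w : dot (u + v) w = dot u w + dot v w.
Proof. by rewrite !dotE !mxE; ring. Qed.

Lemma dotZl c u v : dot (c *: u) v = c * dot u v.
Proof. by rewrite !dotE !mxE; ring. Qed.

Lemma dot0r u : dot u 0 = 0.
Proof. by rewrite dotE !mxE; ring. Qed.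

Lemma crossC u v : cross u v = - cross v u.
Proof. by apply: rowP3; rewrite !mxE; ring. Qed.

Lemma crossvv u : cross u u = 0.
Proof. by apply: rowP3; rewrite !mxE; ring. Qed.

Lemma crossDr u v w : cross u (v + w) = cross u v + cross u w.
Proof. by apply: rowP3; rewrite !mxE; ring. Qed.

Lemma crossZr c u v : cross u (c *: v) = c *: cross u v.
Proof. by apply: rowP3; rewrite !mxE; ring. Qed.

Lemma crossZl c u v : cross (c *: u) v = c *: cross u v.
Proof. by apply: rowP3; rewrite !mxE; ring. Qed.

Lemma dot_cross_l u v : dot u (cross u v) = 0.
Proof. by rewrite dotE !crossE; ring. Qed.

Lemma dot_cross_r u v : dot v (cross u v) = 0.
Proof. by rewrite dotE !crossE; ring. Qed.

Lemma dot_crossCA u v w : dot u (cross v w) = - dot v (cross u w).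
Proof. by rewrite !dotE !crossE; ring. Qed.

Lemma dot_cross_cycle u v w : dot u (cross v w) = dot w (cross u v).
Proof. by rewrite !dotE !crossE; ring. Qed.

Lemma Binet_Cauchy a b u v :
  dot (cross a b) (cross u v) = dot a u * dot b v - dot a v * dot b u.
Proof. by rewrite !dotE !crossE; ring. Qed.

Lemma cross_cross a b v : cross (cross a b) v = dot a v *: b - dot b v *: a.
Proof. by apply: rowP3; rewrite !crossE !mxE !dotE; ring. Qed.

Lemma det3D u v v' w : det3 u (v + v') w = det3 u v w + det3 u v' w.
Proof. by rewrite /det3 !dotE !crossE !mxE; ring. Qed.

Lemma det3B u v v' w : det3 u (v - v') w = det3 u v w - det3 u v' w.
Proof. by rewrite /det3 !dotE !crossE !mxE; ring. Qed.

Lemma det3Z c u v w : det3 u (c *: v) w = c * det3 u v w.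
Proof. by rewrite /det3 !dotE !crossE !mxE; ring. Qed.

Lemma det3Dr u v w w' : det3 u v (w + w') = det3 u v w + det3 u v w'.
Proof. by rewrite /det3 !dotE !crossE !mxE; ring. Qed.

Lemma det3Br u v w w' : det3 u v (w - w') = det3 u v w - det3 u v w'.
Proof. by rewrite /det3 !dotE !crossE !mxE; ring. Qed.

Lemma det3Zr c u v w : det3 u v (c *: w) = c * det3 u v w.
Proof. by rewrite /det3 !dotE !crossE !mxE; ring. Qed.

Lemma det3_swap u v w : det3 u w v = - det3 u v w.
Proof. by rewrite /det3 !dotE !crossE; ring. Qed.

Lemma det3uu u w : det3 u u w = 0.
Proof. exact: dot_cross_l. Qed.

Lemma det3vv u v : det3 u v v = 0.
Proof. by rewrite /det3 crossvv dot0r. Qed.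

Lemma Cramer3 u v w a :
  det3 u v w *: a = det3 a v w *: u + det3 u a w *: v + det3 u v a *: w.
Proof. by apply: rowP3; rewrite /det3 !mxE !dotE !crossE; ring. Qed.

(** This is the adjugate identity for the matrix with rows u, v, w: applying the matrix to [a] and
    then its adjugate multiplies [a] by the determinant. *)
Lemma dot_det3_entry a u v w (i : 'I_3) : det3 u v w * a ord0 i =
  dot a u * cross v w ord0 i + dot a v * cross w u ord0 i
  + dot a w * cross u v ord0 i.
Proof.
by move: i; apply: forall_ord3; rewrite /det3 !dotE !mxE ?ord3_addE; ring.
Qed.

Lemma regroup_scale x y z c k l u v w : y = z + c * l ->
  x *: u + y *: v + (c * k) *: w = x *: u + z *: v + c *: (k *: w + l *: v).
Proof. by move=> ->; apply/rowP => i; rewrite !mxE; ring. Qed.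

End Vectors.

(** Only one coordinate of [n] has to be invertible, so the statement also serves for constant
    vectors over the polynomial ring. *)
Lemma cross_eq0 (R : comUnitRingType) (n w : 'rV[R]_3) (k : 'I_3) :
  n ord0 k \is a GRing.unit -> cross n w = 0 -> w = (w ord0 k / n ord0 k) *: n.
Proof.
move=> uk nw; suff e : n ord0 k *: w = w ord0 k *: n.
  by rewrite mulrC -scalerA -e scalerA mulVr // scale1r.
have e i : cross n w ord0 i = 0 by rewrite nw mxE.
move: {e} (e 0) (e 1) (e 2%:R); rewrite !crossE.
move=> /eqP; rewrite subr_eq0 => /eqP e0.
move=> /eqP; rewrite subr_eq0 => /eqP e1.
move=> /eqP; rewrite subr_eq0 => /eqP e2.
by move: k {uk}; apply: forall_ord3; apply: rowP3; rewrite !mxE;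
  rewrite [RHS]mulrC ?e0 ?e1 ?e2.
Qed.

Lemma row_neq0 (F : fieldType) (n : 'rV[F]_3) :
  n != 0 -> exists k, n ord0 k != 0.
Proof.
by move=> n0; apply/existsP; apply: contraNT n0 => /existsPn h;
  apply/eqP/rowP => i; rewrite mxE; apply/eqP/negPn/h.
Qed.

(** * Linear forms and polynomials *)

Definition divides (R : comNzRingType) (P Q : R) : Prop := exists K, Q = P * K.

(** A row [v] of polynomials stands for the derivation sending X_i to its i-th entry:
    [dot (cst a) v] is then v applied to the form of [a], and [dot (grad f) v] is v(f). *)
Definition cst (F : fieldType) (a : 'rV[F]_3) : 'rV[{mpoly F[3]}]_3 :=
  map_mx (@mpolyC 3 F) a.

Definition euler (F : fieldType) : 'rV[{mpoly F[3]}]_3 := \row_(i < 3) 'X_i.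

HB.lock Definition lform (F : fieldType) (a : 'rV[F]_3) : {mpoly F[3]} :=
  dot (cst a) (euler F).

HB.lock Definition grad (F : fieldType) (f : {mpoly F[3]}) : 'rV[{mpoly F[3]}]_3 :=
  \row_(i < 3) f^`M(i).

Section Forms.

Variable F : fieldType.
Local Notation S := {mpoly F[3]}.
Implicit Types (a b c q w : 'rV[F]_3) (P Q K f : S) (v : 'rV[S]_3).

Lemma cstE a i : cst a ord0 i = (a ord0 i)%:MP.
Proof. by rewrite mxE. Qed.

Lemma dot_cst a b : dot (cst a) (cst b) = (dot a b)%:MP.
Proof. by rewrite !dotE !mxE !rmorphD !rmorphM. Qed.

Lemma cross_cst a b : cross (cst a) (cst b) = cst (cross a b).
Proof. by apply: rowP3; rewrite !mxE rmorphB !rmorphM. Qed.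

Lemma cstZ (x : F) a : cst (x *: a) = x%:MP *: cst a.
Proof. by apply/rowP => i; rewrite !mxE rmorphM. Qed.

Lemma dot_delta a k : dot a (delta_mx ord0 k) = a ord0 k.
Proof.
rewrite dot.unlock (bigD1 k) //= !mxE !eqxx mulr1 big1 ?addr0 // => i ik.
by rewrite mxE (negbTE ik) andbF mulr0.
Qed.

Lemma mpolyC_unit (x : F) : x != 0 -> x%:MP \is a @GRing.unit S.
Proof. by move=> x0; apply: rmorph_unit; rewrite unitfE. Qed.

Lemma cst_parallel q v : q != 0 -> cross (cst q) v = 0 -> exists K, v = K *: cst q.
Proof.
move=> /row_neq0[k qk] /(@cross_eq0 _ (cst q) v k) e; eexists; apply: e.
by rewrite mxE mpolyC_unit.
Qed.

Lemma parallel q w : q != 0 -> cross q w = 0 -> exists x : F, w = x *: q.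
Proof.
move=> /row_neq0[k qk] /(@cross_eq0 _ q w k) e; eexists; apply: e.
by rewrite unitfE.
Qed.

Lemma lformE a : lform a = \sum_i (a ord0 i)%:MP * 'X_i.
Proof.
by rewrite lform.unlock dot.unlock; apply: eq_bigr => i _; rewrite !mxE.
Qed.

Lemma dot_euler a : dot (cst a) (euler F) = lform a.
Proof. by rewrite lform.unlock. Qed.

Lemma meval_lform a w : (lform a).@[fun i => w ord0 i] = dot a w.
Proof.
by rewrite lformE dot.unlock rmorph_sum; apply: eq_bigr => i _;
  rewrite rmorphM /= mevalC mevalXU.
Qed.

Lemma lform_homog a : lform a \is 1.-homog.
Proof.
rewrite lformE rpred_sum // => i _; rewrite mul_mpolyC rpredZ //.
by rewrite dhomogX /= mdeg1.
Qed.

Definition comp_row v : S -> S := comp_mpoly [tuple v ord0 i | i < 3].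

HB.instance Definition _ v := GRing.RMorphism.copy (comp_row v)
  (comp_mpoly [tuple v ord0 i | i < 3]).

Lemma comp_rowC v (x : F) : comp_row v x%:MP = x%:MP.
Proof. exact: comp_mpolyC. Qed.

Lemma comp_rowX v i : comp_row v 'X_i = v ord0 i.
Proof. by rewrite /comp_row comp_mpolyXU -tnth_nth tnth_mktuple. Qed.

Lemma comp_row_lform v a : comp_row v (lform a) = dot (cst a) v.
Proof.
by rewrite lformE dot.unlock rmorph_sum; apply: eq_bigr => i _;
  rewrite rmorphM /= comp_rowC comp_rowX mxE.
Qed.

(** The polynomials congruent to their substitution modulo (P, Q) are closed under sums and
    products, and contain the constants and the variables. *)
Lemma comp_row_congr P Q v v' v'' f :
  (forall i, 'X_i = v ord0 i + P * v' ord0 i + Q * v'' ord0 i) ->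
  exists A B, f = comp_row v f + P * A + Q * B.
Proof.
move=> vE; pose good g := exists A B, g = comp_row v g + P * A + Q * B.
have goodC x : good x%:MP by exists 0, 0; rewrite comp_rowC; ring.
have goodX i : good 'X_i.
  by exists (v' ord0 i), (v'' ord0 i); rewrite comp_rowX.
have goodD g h : good g -> good h -> good (g + h).
  move=> [A [B eg]] [A' [B' eh]]; exists (A + A'), (B + B').
  by rewrite rmorphD /= {1}eg {1}eh; ring.
have goodM g h : good g -> good h -> good (g * h).
  move=> [A [B eg]] [A' [B' eh]].
  exists (A * h + comp_row v g * A'), (B * h + comp_row v g * B').
  by rewrite rmorphM /= {1}eg mulrDl mulrDl {1}eh; ring.
suff: good f by [].
elim/mpolyind: f => [|x m g _ _ gg]; first exact: (goodC 0).
have goodXn i k : good ('X_i ^+ k).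
  elim: k => [|k IHk]; first by rewrite expr0 -mpolyC1; exact: goodC.
  by rewrite exprS; exact: goodM (goodX i) IHk.
apply: (goodD _ _ _ gg); rewrite -mul_mpolyC; apply: (goodM _ _ (goodC x)).
rewrite mpolyXE_id; apply: (big_ind good _ goodM) => [|i _]; last exact: goodXn.
by rewrite -mpolyC1; exact: goodC.
Qed.

(* The retraction is the substitution [X := X - l_a(X) w] for some w with      *)
(* [l_a(w) = 1].                                                               *)
Lemma lform_retract a : a != 0 -> exists s : {rmorphism S -> S},
  s (lform a) = 0 /\ forall f, exists A, f = s f + lform a * A.
Proof.
move=> /row_neq0[k ak]; pose w : 'rV[F]_3 := (a ord0 k)^-1 *: delta_mx ord0 k.
have aw : dot a w = 1.
  by rewrite dotZr dot_delta mulVf.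
pose v := euler F - lform a *: cst w.
exists (comp_row v); split=> [|f] /=.
  rewrite comp_row_lform dotBr dotZr dot_cst aw dot_euler.
  by rewrite mpolyC1 mulr1 subrr.
have [|A [B e]] := @comp_row_congr (lform a) 0 v (cst w) 0 f.
  by move=> i; rewrite !mxE; ring.
by exists A; rewrite {1}e mul0r addr0.
Qed.

(** The retraction [s] maps to a domain and its kernel is generated by the linear form. *)
Lemma lform_prime a P Q : a != 0 ->
  divides (lform a) (P * Q) -> divides (lform a) P \/ divides (lform a) Q.
Proof.
move=> /lform_retract[s [sa sE]] [K /(congr1 s)].
rewrite !rmorphM sa mul0r => /eqP; rewrite mulf_eq0 => /orP[/eqP e|/eqP e].
  by left; have [A eA] := sE P; exists A; rewrite {1}eA e add0r.
by right; have [A eA] := sE Q; exists A; rewrite {1}eA e add0r.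
Qed.

Lemma lform_neq0 a : a != 0 -> lform a != 0.
Proof.
move=> /row_neq0[k]; apply: contraNneq => /(congr1 (meval _)) e.
by rewrite -dot_delta -meval_lform e meval0.
Qed.

Lemma cross_neq0_witness a b : cross a b != 0 ->
  exists2 w, dot a w = 0 & dot b w != 0.
Proof.
move=> /row_neq0[k abk]; exists (cross a (delta_mx ord0 k)).
  exact: dot_cross_l.
by rewrite dot_cross_cycle crossC dotNr oppr_eq0 dotC dot_delta.
Qed.

Lemma lform_ndvd a b : cross a b != 0 -> ~ divides (lform a) (lform b).
Proof.
move=> /cross_neq0_witness[w aw bw] [K /(congr1 (meval (fun i => w ord0 i)))].
by rewrite mevalM !meval_lform aw mul0r => /eqP; apply/negP.
Qed.

(* The retraction is the linear projection onto the common zero [cross a b].   *)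
Lemma lform2_retract a b : cross a b != 0 -> exists2 s : {rmorphism S -> S},
    forall f, exists A B, f = s f + lform a * A + lform b * B &
    forall c, (s (lform c) == 0) = (dot c (cross a b) == 0).
Proof.
move=> ab; have [k qk] := row_neq0 ab.
have [w aw bw] : exists2 w, dot a w = 1 & dot b w = 0.
  exists ((cross a b ord0 k)^-1 *: cross b (delta_mx ord0 k)).
    by rewrite dotZr dot_cross_cycle dotC dot_delta mulVf.
  by rewrite dotZr dot_cross_l mulr0.
have [w' aw' bw'] : exists2 w', dot a w' = 0 & dot b w' = 1.
  exists (- (cross a b ord0 k)^-1 *: cross a (delta_mx ord0 k)).
    by rewrite dotZr dot_cross_l mulr0.
  rewrite dotZr dot_cross_cycle (crossC b) dotNr dotC dot_delta mulrNN.
  by rewrite mulVf.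
set q := cross a b in qk *.
have aq : dot a q = 0 by exact: dot_cross_l.
have bq : dot b q = 0 by exact: dot_cross_r.
pose v := euler F - lform a *: cst w - lform b *: cst w'.
have av : dot (cst a) v = 0.
  rewrite !dotBr !dotZr !dot_cst aw aw' mpolyC0 mpolyC1 dot_euler.
  by rewrite mulr1 mulr0 subr0 subrr.
have bv : dot (cst b) v = 0.
  rewrite !dotBr !dotZr !dot_cst bw bw' mpolyC0 mpolyC1 dot_euler.
  by rewrite mulr1 mulr0 subr0 subrr.
have [K vK] : exists K, v = K *: cst q.
  apply: cst_parallel => //.
  by rewrite -cross_cst cross_cross av bv !scale0r subrr.
clearbody q.
have vE i : 'X_i = v ord0 i + lform a * cst w ord0 i + lform b * cst w' ord0 i.
  by rewrite !entryB !entryZ /euler mxE -addrA [X in _ + X]addrC addrA !subrK.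
exists (comp_row v) => [f|c]; last rewrite -[X in X == 0]/(comp_row v (lform c)).
  by have [A [B e]] := comp_row_congr f vE; exists A, B; exact: e.
rewrite comp_row_lform vK dotZr dot_cst mulf_eq0 mpolyC_eq0.
suff /negbTE -> : K != 0 by [].
(* If K were 0, every coordinate would be a combination of the two forms and would vanish at their
   common zero [q]. *)
apply/negP => /eqP K0; move: vK; rewrite K0 scale0r /v => v0.
have vi i : 'X_i = lform a * (w ord0 i)%:MP + lform b * (w' ord0 i)%:MP.
  move/rowP: v0 => /(_ i); rewrite !entryB !entryZ !mxE => /eqP.
  by rewrite -addrA -opprD subr_eq0 => /eqP.
case/negP: qk; apply/eqP.
move: (congr1 (meval (fun i => q ord0 i)) (vi k)).
by rewrite mevalD !mevalM !meval_lform aq bq !mul0r addr0 mevalXU.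
Qed.

End Forms.

(** * Products of linear forms and tangent fields *)

HB.lock Definition lprod (F : fieldType) (s : seq 'rV[F]_3) : {mpoly F[3]} :=
  \prod_(a <- s) lform a.

Definition nonparallel (F : fieldType) (s : seq 'rV[F]_3) : Prop :=
  [/\ uniq s, {in s, forall a, a != 0} &
      {in s &, forall a b, a != b -> cross a b != 0}].

Definition tangent (F : fieldType) (v : 'rV[{mpoly F[3]}]_3)
    (s : seq 'rV[F]_3) : Prop :=
  forall a, a \in s -> divides (lform a) (dot (cst a) v).

Definition hpart (F : fieldType) (n : nat) : {mpoly F[3]} -> {mpoly F[3]} :=
  pihomog mdeg n.

Definition hrow (F : fieldType) (n : nat) (v : 'rV[{mpoly F[3]}]_3) :=
  map_mx (hpart n) v.

Section Products.

Variable F : fieldType.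
Local Notation S := {mpoly F[3]}.
Implicit Types (a b c q w : 'rV[F]_3) (P Q K f : S) (v : 'rV[S]_3).
Implicit Types (s : seq 'rV[F]_3).

Lemma divides_mulr P Q K : divides P Q -> divides P (Q * K).
Proof. by move=> [L ->]; exists (L * K); rewrite mulrA. Qed.

Lemma dividesD P Q K : divides P Q -> divides P K -> divides P (Q + K).
Proof. by move=> [L ->] [M ->]; exists (L + M); rewrite mulrDr. Qed.

Lemma dividesN P Q : divides P Q -> divides P (- Q).
Proof. by move=> [L ->]; exists (- L); rewrite mulrN. Qed.

Lemma dividesB P Q K : divides P Q -> divides P K -> divides P (Q - K).
Proof. by move=> hQ hK; apply: dividesD hQ (dividesN hK). Qed.

Lemma dvd_mulr P Q : divides P (P * Q).
Proof. by exists Q. Qed.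

Lemma nonparallel_cons a s :
  nonparallel (a :: s) -> [/\ a \notin s, a != 0, nonparallel s &
    {in s, forall b, cross a b != 0}].
Proof.
move=> [/= /andP[as_ us] n0 np]; split=> //; first by apply: n0; rewrite mem_head.
  split=> // [b bs|b c bs cs]; first by apply: n0; rewrite inE bs orbT.
  by apply: np; rewrite inE ?bs ?cs orbT.
move=> b bs; apply: np; rewrite ?inE ?eqxx ?bs ?orbT //.
by apply: contraNneq as_ => ->.
Qed.

Lemma nonparallel_sub s s' : uniq s' -> {subset s' <= s} -> nonparallel s ->
  nonparallel s'.
Proof.
move=> us' sub [_ n0 np]; split=> // [a /sub|a b /sub sa /sub]; first exact: n0.
exact: np.
Qed.

Lemma nonparallel_perm s s' : perm_eq s s' -> nonparallel s -> nonparallel s'.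
Proof.
move=> ss' ns; apply: (nonparallel_sub _ _ ns).
  by rewrite -(perm_uniq ss'); case: ns.
by move=> a; rewrite (perm_mem ss').
Qed.

Lemma lprod_nil : lprod [::] = 1 :> S.
Proof. by rewrite lprod.unlock big_nil. Qed.

Lemma lprod_cons a s : lprod (a :: s) = lform a * lprod s.
Proof. by rewrite !lprod.unlock big_cons. Qed.

Lemma lprod_cat s s' : lprod (s ++ s') = lprod s * lprod s'.
Proof. by rewrite !lprod.unlock big_cat. Qed.

Lemma lprod_perm s s' : perm_eq s s' -> lprod s = lprod s'.
Proof. by rewrite !lprod.unlock; exact: perm_big. Qed.

Lemma lprod_neq0 s : {in s, forall a, a != 0} -> lprod s != 0.
Proof.
elim: s => [|a s IHs] n0; first by rewrite lprod_nil oner_eq0.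
rewrite lprod_cons mulf_neq0 ?lform_neq0 ?n0 ?mem_head //.
by apply: IHs => b bs; apply: n0; rewrite inE bs orbT.
Qed.

Lemma lform_ndvd_lprod a s : a != 0 -> {in s, forall b, cross a b != 0} ->
  ~ divides (lform a) (lprod s).
Proof.
move=> a0; elim: s => [|b s IHs] ab.
  move=> [K]; rewrite lprod_nil => /(congr1 (meval (fun=> 0))).
  rewrite mevalM meval1 -[X in meval X](_ : (fun i => (0 : 'rV[F]_3) ord0 i) = _).
    by rewrite meval_lform dot0r mul0r => /eqP; rewrite oner_eq0.
  by apply/funext => i; rewrite mxE.
rewrite lprod_cons => /(lform_prime a0)[]; first exact/lform_ndvd/ab/mem_head.
by apply: IHs => c cs; apply: ab; rewrite inE cs orbT.
Qed.

(** The factors are pairwise non-associated primes. *)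
Lemma lprod_dvd s P : nonparallel s ->
  (forall a, a \in s -> divides (lform a) P) -> divides (lprod s) P.
Proof.
elim: s => [|a s IHs] ns sP; first by exists P; rewrite lprod_nil mul1r.
have [as_ a0 ns' ab] := nonparallel_cons ns.
have [|K PK] := IHs ns'; first by move=> b bs; apply: sP; rewrite inE bs orbT.
have := sP a (mem_head _ _); rewrite PK => /(lform_prime a0)[].
  by move/(lform_ndvd_lprod a0 ab).
by move=> [L ->]; exists L; rewrite lprod_cons mulrCA mulrA.
Qed.

Lemma gradE P i : grad P ord0 i = P^`M(i).
Proof. by rewrite grad.unlock mxE. Qed.

Lemma grad1 : grad 1 = 0 :> 'rV[S]_3.
Proof. by apply/rowP => i; rewrite gradE -mpolyC1 mderivC mxE. Qed.

Lemma gradM P Q : grad (P * Q) = P *: grad Q + Q *: grad P.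
Proof.
apply/rowP => i; rewrite entryD !entryZ !gradE mderivM addrC.
by rewrite [_ * Q]mulrC.
Qed.

Lemma grad_lform a : grad (lform a) = cst a.
Proof.
apply/rowP => i; rewrite gradE mxE lformE raddf_sum /= (bigD1 i) //=.
rewrite mderiv_mulC mderivX mnm1E eqxx scale1r big1 => [|j ji].
  rewrite addr0 (_ : (_ - _)%MM = 0%MM) ?mpolyX0 ?mulr1 //.
  by apply/mnmP => j; rewrite mnmBE mnm0E subnn.
by rewrite mderiv_mulC mderivX mnm1E (negbTE ji) scale0r mulr0.
Qed.

Lemma tangent_sub s s' v : {subset s' <= s} -> tangent v s -> tangent v s'.
Proof. by move=> sub vs a /sub; apply: vs. Qed.

Lemma tangent_dvd s v : tangent v s ->
  divides (lprod s) (dot (grad (lprod s)) v).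
Proof.
elim: s => [|a s IHs] vs.
  by exists 0; rewrite lprod_nil grad1 dotC dot0r mulr0.
have [|K dK] := IHs; first by apply: tangent_sub vs => b; rewrite inE orbC => ->.
have [L dL] := vs a (mem_head _ _).
exists (K + L); rewrite lprod_cons gradM grad_lform dotDl !dotZl dK dL; ring.
Qed.

(** By the Leibniz rule, modulo the form of one line only the term differentiating that factor
    survives, and its cofactor is prime to the form. *)
Lemma dvd_tangent s v : nonparallel s ->
  divides (lprod s) (dot (grad (lprod s)) v) -> tangent v s.
Proof.
move=> ns [K dK] a as_.
have ps := perm_to_rem as_.
have [_ a0 _ ab] := nonparallel_cons (nonparallel_perm ps ns).
move: dK; rewrite (lprod_perm ps) lprod_cons gradM grad_lform dotDl !dotZl.
move=> dK; have : divides (lform a) (lprod (rem a s) * dot (cst a) v).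
  exists (lprod (rem a s) * K - dot (grad (lprod (rem a s))) v).
  by rewrite mulrBr mulrA -dK; ring.
by move=> /(lform_prime a0)[/(lform_ndvd_lprod a0 ab)|].
Qed.

Lemma dot_grad_euler s :
  dot (grad (lprod s)) (euler F) = (size s)%:R * lprod s.
Proof.
elim: s => [|a s IHs].
  by rewrite lprod_nil grad1 dotC dot0r mul0r.
rewrite lprod_cons gradM grad_lform dotDl !dotZl IHs dot_euler /=.
by rewrite -[(size s).+1]addn1 natrD; ring.
Qed.

Lemma lprod_homog s : lprod s \is (size s).-homog.
Proof.
elim: s => [|a s IHs]; first by rewrite lprod_nil dhomog1.
by rewrite lprod_cons; exact: dhomogM (lform_homog a) IHs.
Qed.

Lemma hpart_is_linear n : linear (@hpart F n).
Proof. exact: pihomog_is_linear. Qed.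

HB.instance Definition _ n := GRing.isLinear.Build F S S _ (@hpart F n)
  (@hpart_is_linear n).

Lemma hpartP n f : hpart n f \is n.-homog.
Proof. exact: pihomogP. Qed.

Lemma hpart_id n f : f \is n.-homog -> hpart n f = f.
Proof. exact: pihomog_dE. Qed.

Lemma hpart_neq n k f : f \is n.-homog -> n != k -> hpart k f = 0.
Proof. by move=> hf nk; apply: pihomog_ne0 hf. Qed.

Lemma hpartM n k P f : P \is n.-homog -> hpart (n + k) (P * f) = P * hpart k f.
Proof.
move=> hP; rewrite [in LHS](pihomog_partitionE (leqnn (mmeasure mdeg f))).
rewrite [in RHS](pihomog_partitionE (leqnn (mmeasure mdeg f))).
rewrite mulr_sumr !raddf_sum /= mulr_sumr; apply: eq_bigr => i _.
have hi := pihomogP mdeg i f; have [<-|ik] := eqVneq (i : nat) k.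
  by rewrite !hpart_id // dhomogM.
by rewrite (hpart_neq hi ik) mulr0 (hpart_neq (dhomogM hP hi)) // eqn_add2l.
Qed.

Lemma hpartM_lt n k P f : P \is n.-homog -> (k < n)%N -> hpart k (P * f) = 0.
Proof.
move=> hP kn; rewrite (pihomog_partitionE (leqnn (mmeasure mdeg f))).
rewrite mulr_sumr !raddf_sum /= big1 // => i _.
rewrite (hpart_neq (dhomogM hP (pihomogP mdeg i f))) //.
by rewrite gtn_eqF // ltn_addr.
Qed.

Lemma hpart_dot_cst n a v : hpart n (dot (cst a) v) = dot (cst a) (hrow n v).
Proof.
rewrite dot.unlock raddf_sum; apply: eq_bigr => i _.
by rewrite !mxE /= !mul_mpolyC; exact: linearZ.
Qed.

(** Tangency to lines through the origin is a graded condition, so any tangent field may be replaced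
    by one of its homogeneous parts. *)
Lemma tangent_hrow n s v : tangent v s -> tangent (hrow n v) s.
Proof.
move=> vs a /vs[K aK]; rewrite -hpart_dot_cst aK; case: n => [|n].
  by rewrite (hpartM_lt _ (lform_homog a)) //; exists 0; rewrite mulr0.
by rewrite (hpartM n _ (lform_homog a)); eexists.
Qed.

Lemma homog0_const f : f \is 0.-homog -> exists x : F, f = x%:MP.
Proof.
move=> hf; exists f@_0; apply/mpolyP => m; rewrite mcoeffC.
have [->|m0] := eqVneq m 0%MM; first by rewrite mulr1.
by rewrite mulr0 (dhomog_nemf_coeff hf) // mdeg_eq0.
Qed.

End Products.

(** * Extending a tangent field by one line *)

Section Interpolation.

Variable F : numFieldType.
Local Notation S := {mpoly F[3]}.
Implicit Types (a b c g p q w : 'rV[F]_3) (P Q K f : S) (v t : 'rV[S]_3).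
Implicit Types (s gs hs : seq 'rV[F]_3).

Lemma span2 g b c : cross g b != 0 -> dot c (cross g b) = 0 ->
  exists x y : F, c = x *: g + y *: b.
Proof.
move=> /row_neq0[k nk] cgb; pose e : 'rV[F]_3 := delta_mx ord0 k.
have := Cramer3 g b e c; rewrite /det3 dot_cross_cycle dotC dot_delta.
rewrite [dot g (cross b c)]dot_cross_cycle cgb scale0r addr0 => e1.
exists (dot c (cross b e) / cross g b ord0 k), (dot g (cross c e) / cross g b ord0 k).
apply: (scalerI nk); rewrite e1 scalerDr !scalerA.
by congr (_ *: _ + _ *: _); rewrite mulrC divfK.
Qed.

Lemma killed2 g1 g2 p v : cross g1 g2 != 0 -> p != 0 ->
  dot g1 p = 0 -> dot g2 p = 0 ->
  dot (cst g1) v = 0 -> dot (cst g2) v = 0 -> exists K, v = K *: cst p.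
Proof.
move=> g12 p0 g1p g2p g1v g2v; apply: cst_parallel => //.
have [|x ->] := @parallel _ (cross g1 g2) p g12.
  by rewrite cross_cross g1p g2p !scale0r subrr.
by rewrite cstZ crossZl -cross_cst cross_cross g1v g2v !scale0r subrr scaler0.
Qed.

Lemma parallel_killed2 g1 g2 p : cross g1 g2 != 0 ->
  dot g1 p = 0 -> dot g2 p = 0 -> exists x : F, p = x *: cross g1 g2.
Proof.
move=> g12 g1p g2p; apply: parallel => //.
by rewrite cross_cross g1p g2p !scale0r subrr.
Qed.

(** On the plane l_a = 0 the three vectors are all annihilated by [a], hence dependent. *)
Lemma det3_dvd a (u v w : 'rV[S]_3) : a != 0 ->
  divides (lform a) (dot (cst a) u) -> divides (lform a) (dot (cst a) v) ->
  divides (lform a) (dot (cst a) w) -> divides (lform a) (det3 u v w).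
Proof.
move=> /row_neq0[k ak] [U eu] [V ev] [W ew].
have := dot_det3_entry (cst a) u v w k; rewrite cstE eu ev ew => e.
exists ((a ord0 k)^-1%:MP * (U * cross v w ord0 k + V * cross w u ord0 k
   + W * cross u v ord0 k)).
have -> : det3 u v w = (a ord0 k)^-1%:MP * (det3 u v w * (a ord0 k)%:MP).
  by rewrite mulrCA -mpolyCM mulVf // mulr1.
by rewrite e; ring.
Qed.

Lemma prod_filter (P : pred 'rV[F]_3) s :
  lprod s = lprod (filter P s) * lprod (filter (predC P) s).
Proof. by rewrite -lprod_cat; apply: lprod_perm; rewrite perm_sym perm_filterC. Qed.

Lemma retract_lprod_neq0 (r : {rmorphism S -> S}) s :
  {in s, forall a, r (lform a) != 0} -> r (lprod s) != 0.
Proof.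
elim: s => [|a s IHs] rs; first by rewrite lprod_nil rmorph1 oner_eq0.
rewrite lprod_cons rmorphM mulf_neq0 ?rs ?mem_head //.
by apply: IHs => b bs; apply: rs; rewrite inE bs orbT.
Qed.

(* At a common point [q] of [a], [b] and [g], the field [t] is tangent to all  *)
(* lines of [s] through [q], and this already forces [t(l_a)] to vanish on [a] *)
(* at [q] to the order given by these lines.                                   *)
Lemma local_tangency g a b s t :
  cross a b != 0 -> dot g (cross a b) = 0 -> cross g b != 0 ->
  nonparallel s -> {in s, forall c, dot c (cross a b) = 0} ->
  {in s, forall c, cross c b != 0} -> {in s, forall c, cross c g != 0} ->
  divides (lform g) (dot (cst g) t) -> divides (lform b) (dot (cst b) t) ->
  tangent t s ->
  exists K L, dot (cst a) t = lform g * lprod s * K + lform a * L.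
Proof.
move=> ab gab gb ns sq sb sg [A gA] [B bB] ts.
(* The lines through the point form a pencil spanned by [g] and [b], so t(l_c) is determined by the
   quotients A and B. *)
have comb c : dot c (cross g b) = 0 -> cross c b != 0 ->
    exists2 x : F, x != 0 &
    dot (cst c) t = lform c * B + x%:MP * (lform g * (A - B)).
  move=> /(span2 gb)[x [y ce]] cb; exists x.
    apply: contraNneq cb => x0.
    by rewrite ce x0 scale0r add0r crossZl crossvv scaler0.
  have -> : lform c = x%:MP * lform g + y%:MP * lform b.
    by rewrite -!dot_euler -!dotZl -dotDl -!cstZ -map_mxD -ce.
  have -> : cst c = x%:MP *: cst g + y%:MP *: cst b by rewrite ce -!cstZ -map_mxD.
  by rewrite dotDl !dotZl gA bB; ring.
have agb : dot a (cross g b) = 0 by rewrite dot_crossCA gab oppr0.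
have qgb c : dot c (cross a b) = 0 -> dot c (cross g b) = 0.
  have [x [y ae]] := span2 gb agb.
  have abE : cross a b = x *: cross g b.
    rewrite ae (crossC _ b) crossDr crossZr crossZr crossvv scaler0 addr0.
    by rewrite -scalerN -crossC.
  rewrite abE dotZr => /eqP; rewrite mulf_eq0 => /orP[/eqP x0|/eqP //].
  by case/eqP: ab; rewrite abE x0 scale0r.
have [x x0 aE] := comb a agb ab.
(* Tangency to each [c] in [s] makes l_c divide l_g (A - B), and l_c does not divide l_g. *)
have [K KE] : divides (lprod s) (A - B).
  apply: lprod_dvd => // c cs.
  have [y y0 cE] := comb c (qgb _ (sq c cs)) (sb c cs).
  have c0 : c != 0 by case: ns => _ /(_ c cs).
  have : divides (lform c) (lform g * (A - B)).
    have -> : lform g * (A - B) = y^-1%:MP * (dot (cst c) t - lform c * B).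
      by rewrite cE [lform c * B + _]addrC addrK mulrA -mpolyCM mulVf // mul1r.
    rewrite mulrC; apply: divides_mulr; apply: dividesB; first exact: ts.
    exact: dvd_mulr.
  by move=> /(lform_prime c0)[/(lform_ndvd (sg c cs))|].
by exists (x%:MP * K), B; rewrite aE KE; ring.
Qed.

(** Restricted to the line [a], t(l_a) vanishes at each point of [a] on lines of [s], to an order at
    least the number of these lines; so it is divisible there by the product of [s]. Each such point
    must lie on a line of [gs] for [local_tangency] to apply. The induction absorbs one line [b] at
    a time. *)
Lemma tangent_step gs s a t :
  nonparallel (a :: s) -> {in gs & a :: s, forall g b, cross b g != 0} ->
  {in s, forall b, exists2 g, g \in gs & dot g (cross a b) = 0} ->
  tangent t gs -> tangent t s ->
  exists K L, dot (cst a) t = lprod s * K + lform a * L.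
Proof.
elim: s => [|b s IHs] ns gns md tg ts.
  by exists (dot (cst a) t), 0; rewrite lprod_nil; ring.
have [/= + a0 nbs ab] := nonparallel_cons ns; rewrite inE negb_or => /andP[nab nas].
have [nbs' b0 nss bs] := nonparallel_cons nbs.
have sub : {subset a :: s <= [:: a, b & s]}.
  by move=> c; rewrite !inE => /orP[->|->]; rewrite ?orbT.
have [||||C [D aE]] := IHs _ _ _ tg _.
- by apply: nonparallel_sub ns => //=; rewrite nas; case: nss.
- by move=> g c gg /sub; apply: gns.
- by move=> c cs; apply: md; rewrite inE cs orbT.
- by apply: tangent_sub ts => c cs; rewrite inE cs orbT.
have abn : cross a b != 0 by apply: ab; rewrite mem_head.
have [g gg gab] := md b (mem_head _ _).
set P := [pred c | dot c (cross a b) == 0].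
have [r rE r0] := lform2_retract abn.
have [K [L aE']] : exists K L,
    dot (cst a) t = lform g * lprod (filter P s) * K + lform a * L.
  apply: (@local_tangency g a b) => //.
  - rewrite crossC oppr_eq0; apply: gns => //; by rewrite !inE eqxx orbT.
  - apply: (nonparallel_sub _ _ nss); first by apply: filter_uniq; case: nss.
    by move=> c; rewrite mem_filter => /andP[].
  - by move=> c; rewrite mem_filter => /andP[/eqP].
  - by move=> c; rewrite mem_filter => /andP[_ /bs]; rewrite crossC oppr_eq0.
  - move=> c; rewrite mem_filter => /andP[_ cs]; apply: gns => //.
    by rewrite !inE cs !orbT.
  - exact: tg.
  - by apply: ts; rewrite mem_head.
  - apply: tangent_sub ts => c; rewrite mem_filter => /andP[_ cs].
    by rewrite inE cs orbT.
(* The two expressions of t(l_a) are compared modulo l_a, after splitting [s] into the lines through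
   the point of [a] and [b] and the others. *)
have : divides (lform a) (lprod (filter P s) *
    (lprod (filter (predC P) s) * C - lform g * K)).
  exists (L - D); move/eqP: aE'; rewrite aE (prod_filter P) -subr_eq0 => /eqP e.
  by apply/eqP; rewrite -subr_eq0 -e; apply/eqP; ring.
move=> /(lform_prime a0)[/lform_ndvd_lprod|[M /(congr1 r)]].
  case=> // c; rewrite mem_filter => /andP[_ cs].
  by apply: ab; rewrite inE cs orbT.
have ra : r (lform a) = 0 by apply/eqP; rewrite r0 dot_cross_l.
have rg : r (lform g) = 0 by apply/eqP; rewrite r0 gab.
(* At that point l_g vanishes and the lines outside P do not, so C vanishes there, that is, C lies
   in the ideal (l_a, l_b). *)
rewrite rmorphB !rmorphM ra rg !mul0r subr0 => /eqP; rewrite mulf_eq0.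
have /negbTE -> /= : r (lprod (filter (predC P) s)) != 0.
  by apply: retract_lprod_neq0 => c; rewrite mem_filter /= -r0 => /andP[].
move=> /eqP rC; have [U [V]] := rE C; rewrite rC add0r => CE.
by exists V, (D + lprod s * U); rewrite aE CE lprod_cons; ring.
Qed.

End Interpolation.

(** * Fields tangent to a pencil, and their determinant with E and p *)

Section Pencil.

Variable F : numFieldType.
Local Notation S := {mpoly F[3]}.
Local Notation E := (euler F).
Implicit Types (a b c g p q w : 'rV[F]_3) (P Q K f : S) (v t : 'rV[S]_3).
Implicit Types (s gs hs : seq 'rV[F]_3).

Lemma grad_killed gs p : {in gs, forall a, dot a p = 0} ->
  dot (grad (lprod gs)) (cst p) = 0.
Proof.
elim: gs => [|a s IHs] kp; first by rewrite lprod_nil grad1 dotC dot0r.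
rewrite lprod_cons gradM grad_lform dotDl !dotZl dot_cst kp ?mem_head //.
rewrite IHs ?mpolyC0 ?mulr0 ?addr0 // => b bs.
by apply: kp; rewrite inE bs orbT.
Qed.

(** The cross product of the gradient of g with a constant vector annihilates g, hence is tangent to
    its lines. Euler's formula evaluates the determinant; the constant vector is a basis vector on
    which p has a nonzero coordinate. *)
Lemma pencil_field gs p : p != 0 -> nonparallel gs -> (0 < size gs)%N ->
  {in gs, forall a, dot a p = 0} ->
  exists (t : 'rV[S]_3) (k : F), [/\ k != 0, tangent t gs &
    det3 E t (cst p) = k%:MP * lprod gs].
Proof.
move=> p0 ns s0 kp; have [i pi] := row_neq0 p0.
exists (cross (grad (lprod gs)) (cst (delta_mx ord0 i))).
exists (- (p ord0 i * (size gs)%:R)); split.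
- by rewrite oppr_eq0 mulf_neq0 // pnatr_eq0 -lt0n.
- by apply: dvd_tangent => //; exists 0; rewrite dot_cross_l mulr0.
rewrite /det3 cross_cross grad_killed // scale0r sub0r dotNr dotZr.
rewrite [dot E _]dotC dot_grad_euler dot_cst dotC dot_delta.
by rewrite mpolyCN mpolyCM mpolyC_nat; ring.
Qed.

(* When [p] is a modular point of [gs ++ hs]; only the homogeneous part of     *)
(* degree [size gs - 1] of the field constructed here matters.                 *)
Lemma modular_field gs hs p : p != 0 -> nonparallel gs -> nonparallel hs ->
  (0 < size gs)%N ->
  {in gs, forall a, dot a p = 0} -> {in hs, forall a, dot a p != 0} ->
  {in gs & hs, forall g b, cross b g != 0} ->
  {in hs &, forall a b, a != b -> exists2 g, g \in gs & dot g (cross a b) = 0} ->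
  exists (t : 'rV[S]_3) (k : F), [/\ k != 0, tangent t gs, tangent t hs &
    det3 E t (cst p) = k%:MP * lprod gs].
Proof.
move=> p0 ng nh g0 gp; elim: hs nh => [|a s IHs] nh hp gh md.
  have [t [k [k0 tg et]]] := pencil_field p0 ng g0 gp.
  by exists t, k; split.
have [as_ a0 ns ab] := nonparallel_cons nh.
have sub : {subset s <= a :: s} by move=> b; rewrite inE orbC => ->.
have [|||t [k [k0 tg ts et]]] := IHs ns.
- by move=> b /sub; apply: hp.
- by move=> g b gg /sub; apply: gh.
- by move=> b c /sub bs /sub cs; apply: md.
have [|K [L aE]] := tangent_step nh gh _ tg ts.
  move=> b bs; apply: md; rewrite ?mem_head ?sub //.
  by apply: contraNneq as_ => ->.
have ap : dot a p != 0 by apply: hp; rewrite mem_head.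
pose x := (dot a p)^-1.
have xa : x%:MP * (dot a p)%:MP = 1 :> S by rewrite -mpolyCM mulVf.
(* Subtracting a multiple of p corrects t along the new line [a]. It keeps tangency to [gs], whose
   covectors kill p, and to [s], because of the factor [lprod s]; the determinant is unchanged. *)
exists (t - (x%:MP * K * lprod s) *: cst p), k; split; first exact: k0.
- by move=> g gg; rewrite dotBr dotZr dot_cst gp // mpolyC0 mulr0 subr0; apply: tg.
- move=> b; rewrite inE dotBr dotZr dot_cst => /orP[/eqP->|bs].
    exists L; rewrite aE; apply/eqP; rewrite -subr_eq0; apply/eqP.
    by transitivity (lprod s * K * (1 - x%:MP * (dot a p)%:MP));
      [ring | rewrite xa subrr mulr0].
  apply: dividesB; first exact: ts.
  rewrite mulrC mulrA (lprod_perm (perm_to_rem bs)) lprod_cons.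
  by eexists; rewrite mulrCA.
- by rewrite det3B det3Z det3vv mulr0 subr0.
Qed.

Definition mev p v : 'rV[F]_3 := map_mx (meval (fun i => p ord0 i)) v.

Lemma mev_dot p v t : (dot v t).@[fun i => p ord0 i] = dot (mev p v) (mev p t).
Proof.
rewrite !dot.unlock rmorph_sum; apply: eq_bigr => i _.
by rewrite rmorphM !mxE.
Qed.

Lemma mev_cross p v t : mev p (cross v t) = cross (mev p v) (mev p t).
Proof. by apply/rowP => i; rewrite !mxE rmorphB !rmorphM. Qed.

Lemma mev_cst p a : mev p (cst a) = a.
Proof. by apply/rowP => i; rewrite !mxE mevalC. Qed.

Lemma mev_euler p : mev p E = p.
Proof. by apply/rowP => i; rewrite !mxE mevalXU. Qed.

(* Both [q] and the value of [v] at [q] lie on the line [b1 = b2 = 0].         *)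
Lemma det3_vanish b1 b2 q w v : cross b1 b2 != 0 -> dot b1 q = 0 -> dot b2 q = 0 ->
  tangent v [:: b1; b2] -> (det3 E v (cst w)).@[fun i => q ord0 i] = 0.
Proof.
move=> b12 b1q b2q vb.
have kil b : b \in [:: b1; b2] -> dot b q = 0 -> dot b (mev q v) = 0.
  move=> /vb[K bK] bq; rewrite -[b in LHS](mev_cst q) -mev_dot bK mevalM.
  by rewrite meval_lform bq mul0r.
have [x qx] := parallel_killed2 b12 b1q b2q.
have [||y vy] := @parallel_killed2 _ b1 b2 (mev q v) b12.
- by apply: kil; rewrite ?inE ?eqxx.
- by apply: kil; rewrite ?inE ?eqxx ?orbT.
rewrite /det3 mev_dot mev_cross mev_cst mev_euler vy {1}qx crossZl dotZr dotZl.
by rewrite dot_cross_l !mulr0.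
Qed.

Lemma lprod_killed s q : {in s, forall a, dot a q != 0} ->
  (lprod s).@[fun i => q ord0 i] != 0.
Proof.
elim: s => [|a s IHs] sq; first by rewrite lprod_nil meval1 oner_eq0.
rewrite lprod_cons mevalM meval_lform mulf_neq0 ?sq ?mem_head //.
by apply: IHs => b bs; apply: sq; rewrite inE bs orbT.
Qed.

(** Evaluation at [q] kills the determinant but not the product of [s]. This is where the
    exceptional double point enters. *)
Lemma det3_const0 s b1 b2 q w v (k : F) :
  cross b1 b2 != 0 -> dot b1 q = 0 -> dot b2 q = 0 ->
  {in s, forall a, dot a q != 0} -> tangent v [:: b1; b2] ->
  det3 E v (cst w) = k%:MP * lprod s -> k = 0.
Proof.
move=> b12 b1q b2q sq vb /(congr1 (meval (fun i => q ord0 i))).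
rewrite (det3_vanish w b12 b1q b2q vb) mevalM mevalC => /esym/eqP.
by rewrite mulf_eq0 (negbTE (lprod_killed sq)) orbF => /eqP.
Qed.

Lemma tangent_euler s : tangent E s.
Proof. by move=> a _; rewrite dot_euler; exists 1; rewrite mulr1. Qed.

Lemma lprod_dvd_det3 s (u v w : 'rV[S]_3) : nonparallel s ->
  tangent u s -> tangent v s -> tangent w s -> divides (lprod s) (det3 u v w).
Proof.
move=> ns us vs ws; apply: lprod_dvd => // a as_.
by apply: det3_dvd; [case: ns => _ /(_ a as_) | apply: us | apply: vs | apply: ws].
Qed.

Lemma tangent_cst s p : {in s, forall a, dot a p = 0} -> tangent (cst p) s.
Proof.
by move=> sp a /sp e; exists 0; rewrite dot_cst e mpolyC0 mulr0.
Qed.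

Lemma tangent_cat v s s' : tangent v s -> tangent v s' -> tangent v (s ++ s').
Proof. by move=> vs vs' a; rewrite mem_cat => /orP[/vs|/vs']. Qed.

(** Since p is proportional to the cross product of [g1] and [g2], the Binet-Cauchy identity turns
    the vanishing determinant into l_g1 v(l_g2) = l_g2 v(l_g1). So v - b E, with b = v(l_g1) / l_g1,
    is killed by both covectors. *)
Lemma det3_eq0 g1 g2 p v : cross g1 g2 != 0 -> p != 0 -> g1 != 0 ->
  dot g1 p = 0 -> dot g2 p = 0 ->
  divides (lform g1) (dot (cst g1) v) -> det3 E v (cst p) = 0 ->
  exists b c : S, v = b *: E + c *: cst p.
Proof.
move=> g12 p0 g10 g1p g2p [b g1v] d0.
have [x pE] := parallel_killed2 g12 g1p g2p.
have x0 : x != 0 by apply: contraNneq p0 => x0; rewrite pE x0 scale0r.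
have d1 : dot (cst (cross g1 g2)) (cross E v) = 0.
  have : x%:MP * dot (cst (cross g1 g2)) (cross E v) = 0.
    by rewrite -dotZl -cstZ -pE -dot_cross_cycle.
  by move/eqP; rewrite mulf_eq0 mpolyC_eq0 (negbTE x0) => /eqP.
have [||c vE] := @killed2 _ g1 g2 p (v - b *: E) g12 p0 g1p g2p.
- by rewrite dotBr dotZr dot_euler g1v mulrC subrr.
- move: d1; rewrite -cross_cst Binet_Cauchy !dot_euler g1v.
  rewrite -mulrA -mulrBr => /eqP; rewrite mulf_eq0 (negbTE (lform_neq0 g10)) /=.
  by rewrite dotBr dotZr dot_euler => /eqP.
by exists b, c; rewrite -vE addrC subrK.
Qed.

End Pencil.

(** * Syzygies and freeness *)

Section Syzygies.

Variable F : numFieldType.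
Local Notation S := {mpoly F[3]}.
Local Notation E := (euler F).
Implicit Types (a b c g p q w : 'rV[F]_3) (P Q K f : S) (v t u : 'rV[S]_3).
Implicit Types (s gs hs : seq 'rV[F]_3).

Definition row_homog n v := forall i, v ord0 i \is n.-homog.

Lemma hrowE n v i : hrow n v ord0 i = hpart n (v ord0 i).
Proof. by rewrite mxE. Qed.

Lemma hrow_homog n v : row_homog n (hrow n v).
Proof. by move=> i; rewrite hrowE hpartP. Qed.

Lemma hrow_id n v : row_homog n v -> hrow n v = v.
Proof. by move=> hv; apply/rowP => i; rewrite hrowE hpart_id. Qed.

Lemma hrowD n v t : hrow n (v + t) = hrow n v + hrow n t.
Proof. by apply/rowP => i; rewrite entryD !hrowE entryD; exact: raddfD. Qed.

Lemma hrowD3 n v t u : hrow n (v + t + u) = hrow n v + hrow n t + hrow n u.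
Proof. by rewrite hrowD; congr (_ + _); exact: hrowD. Qed.

Lemma hrow_cst n P p : hrow n (P *: cst p) = hpart n P *: cst p.
Proof.
apply/rowP => i; rewrite hrowE !entryZ cstE mulrC [RHS]mulrC !mul_mpolyC.
exact: linearZ.
Qed.

Lemma eulerE i : E ord0 i = 'X_i.
Proof. by rewrite mxE. Qed.

Lemma euler_homog : row_homog 1 E.
Proof. by move=> i; rewrite eulerE dhomogX /= mdeg1. Qed.

Lemma cst_homog p : row_homog 0 (cst p).
Proof. by move=> i; rewrite cstE -[_%:MP]mulr1 mul_mpolyC rpredZ ?dhomog1. Qed.

Lemma hrow_scale k n P v : P \is k.-homog ->
  hrow (k + n) (P *: v) = P *: hrow n v.
Proof. by move=> hP; apply/rowP => i; rewrite hrowE !entryZ hrowE (hpartM _ _ hP). Qed.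

Lemma hrow_euler n P : exists K, hrow n (P *: E) = K *: E.
Proof.
case: n => [|n]; [exists 0 | exists (hpart n P)].
  apply/rowP => i; rewrite hrowE !entryZ mul0r mulrC.
  exact: hpartM_lt (euler_homog i) _.
apply/rowP => i; rewrite hrowE !entryZ mulrC [RHS]mulrC.
exact: hpartM (euler_homog i).
Qed.

Lemma hpart_dot k n u v : row_homog k u ->
  hpart (k + n) (dot u v) = dot u (hrow n v).
Proof.
move=> hu; rewrite dot.unlock raddf_sum; apply: eq_bigr => i _ /=.
by rewrite (hpartM _ _ (hu i)) hrowE.
Qed.

Lemma cross_homog k n u v : row_homog k u -> row_homog n v ->
  row_homog (k + n) (cross u v).
Proof. by move=> hu hv i; rewrite mxE rpredB ?dhomogM. Qed.

Lemma det3_cycle u v t : det3 u v t = dot (cross t u) v.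
Proof. by rewrite /det3 dot_cross_cycle dot_cross_cycle dotC. Qed.

Lemma hpart_det3_euler k n t v : row_homog k t ->
  hpart (k + n).+1 (det3 E t v) = det3 E t (hrow n v).
Proof.
move=> ht; rewrite /det3 !(dot_cross_cycle E t) !(dotC _ (cross E t)).
exact: hpart_dot (cross_homog euler_homog ht).
Qed.

Lemma hpart_det3 n p v :
  hpart n.+1 (det3 E v (cst p)) = det3 E (hrow n v) (cst p).
Proof.
by rewrite !det3_cycle (hpart_dot _ _ (cross_homog (cst_homog p) euler_homog)).
Qed.

Lemma syzygyE f v : syzygy f v <-> dot v (grad f) = 0.
Proof.
rewrite /syzygy dot.unlock (eq_bigr (fun i => v ord0 i * grad f ord0 i)) //.
by move=> i _; rewrite gradE.
Qed.

Lemma row_homogB n u v : row_homog n u -> row_homog n v -> row_homog n (u - v).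
Proof. by move=> hu hv i; rewrite entryB rpredB. Qed.

(** Tangency gives v(f) = K f, and E(f) = deg(f) f with deg(f) invertible, so a multiple of E
    corrects v into a syzygy of the same degree. *)
Lemma tangent_AR s n v : (0 < size s)%N -> tangent v s -> row_homog n.+1 v ->
  exists K, AR (lprod s) n.+1 (v - K *: E).
Proof.
move=> s0 vs hv; have [K vK] := tangent_dvd vs.
have d0 : (size s)%:R != 0 :> F by rewrite pnatr_eq0 -lt0n.
have gh : row_homog (size s).-1 (grad (lprod s)).
  by move=> i; rewrite gradE mderiv_homog // lprod_homog.
have {}vK : dot (grad (lprod s)) v = lprod s * hpart n K.
  have := hpart_dot n.+1 v gh; rewrite (hrow_id hv) => <-.
  rewrite vK -addSnnS prednK //; exact: hpartM (lprod_homog s).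
exists ((size s)%:R^-1%:MP * hpart n K); split=> [|].
  apply: (row_homogB hv) => i; rewrite entryZ mul_mpolyC -scalerAl rpredZ //.
  by rewrite mulrC; exact: dhomogM (euler_homog i) (hpartP n K).
apply/syzygyE; rewrite dotC dotBr dotZr vK dot_grad_euler -mpolyC_nat.
rewrite mulrACA -mpolyCM mulVf // mul1r.
by rewrite mulrC subrr.
Qed.

Lemma AR_tangent s n v : nonparallel s -> AR (lprod s) n v -> tangent v s.
Proof.
move=> ns [_ /syzygyE e]; apply: dvd_tangent => //; exists 0.
by rewrite dotC e mulr0.
Qed.

(** Cramer's rule expands k f v on E, t and u. For a syzygy v the coefficient of E vanishes on
    pairing with the gradient of f. The other two are determinants of tangent fields, hence
    divisible by f, which cancels. *)
Lemma Saito s n t u (k : F) : nonparallel s -> (0 < size s)%N -> k != 0 ->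
  AR (lprod s) n t -> AR (lprod s) n u -> det3 E t u = k%:MP * lprod s ->
  free_arrangement (lprod s).
Proof.
move=> ns s0 k0 tAR uAR tu; have ts := AR_tangent ns tAR.
have us := AR_tangent ns uAR.
have /syzygyE tf := proj2 tAR; have /syzygyE uf := proj2 uAR.
have f0 : lprod s != 0 by apply: lprod_neq0; case: ns.
have kf0 : k%:MP * lprod s != 0 by rewrite mulf_neq0 // mpolyC_eq0.
pose M : 'M[S]_(2, 3) := \matrix_(i < 2) (if i == 0 then t else u).
have mulM (c : 'rV[S]_2) : c *m M = c ord0 0 *: t + c ord0 1 *: u.
  rewrite mulmx_sum_row !big_ord_recl big_ord0 addr0 !rowK /=.
  by congr (_ *: _ + c _ _ *: _); apply: val_inj.
exists 2, M, (fun=> n); split=> [i|v /syzygyE vf].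
  by rewrite rowK; case: ifP.
have vs : tangent v s by apply: dvd_tangent => //; exists 0; rewrite dotC vf mulr0.
have Es := @tangent_euler _ s.
have [x ex] := lprod_dvd_det3 ns Es vs us.
have [y ey] := lprod_dvd_det3 ns Es ts vs.
have cram := Cramer3 E t u v.
(* Pairing Cramer's identity with the gradient leaves det(v, t, u) deg(f) f = 0. *)
have z0 : det3 v t u = 0.
  have := congr1 (fun w : 'rV[S]_3 => dot w (grad (lprod s))) cram.
  rewrite 2!dotDl !dotZl tf uf vf 3!mulr0 2!addr0 [dot E _]dotC.
  rewrite dot_grad_euler => /esym/eqP; rewrite mulf_eq0 mulf_eq0.
  by rewrite (negbTE f0) -mpolyC_nat mpolyC_eq0 pnatr_eq0 eqn0Ngt s0 /= orbF => /eqP.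
have kk : k%:MP * k^-1%:MP = 1 :> S by rewrite -mpolyCM mulfV.
pose c0 : 'rV[S]_2 := \row_i (k^-1%:MP * (if i == 0 then x else y)).
have c00 : c0 ord0 0 = k^-1%:MP * x by rewrite mxE.
have c01 : c0 ord0 1 = k^-1%:MP * y by rewrite mxE.
have uniq_coef (z w : S) :
    lprod s * z = w * (k%:MP * lprod s) -> k^-1%:MP * z = w.
  move=> e; apply: (mulfI kf0); rewrite [RHS]mulrC -e.
  by transitivity (k%:MP * k^-1%:MP * (lprod s * z)); [ring | rewrite kk mul1r].
exists c0; split=> [|c].
  rewrite mulM c00 c01; apply/rowP => i; apply: (mulfI kf0).
  have /rowP/(_ i) := cram; rewrite z0 scale0r add0r tu ex ey.
  rewrite !entryD !entryZ => ->.
  rewrite -[LHS]mul1r -kk; ring.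
rewrite mulM => vE; apply/rowP => i; suff [e0 e1] : c0 ord0 0 = c ord0 0 /\
    c0 ord0 1 = c ord0 1.
  by case: i => [[|[|//]] lti]; [move: e0 | move: e1];
    congr (c0 _ _ = c _ _); apply: val_inj.
rewrite c00 c01; split; apply: uniq_coef.
  by rewrite -ex -tu vE det3D !det3Z det3vv mulr0 addr0.
by rewrite -ey -tu vE det3Dr !det3Zr det3vv mulr0 add0r.
Qed.

End Syzygies.

(** * Near-pencils *)

Section NearPencil.

Variable F : numFieldType.
Local Notation S := {mpoly F[3]}.
Local Notation E := (euler F).
Implicit Types (a b c g w : 'rV[F]_3) (P Q K f : S) (v t u : 'rV[S]_3).
Implicit Types (s : seq 'rV[F]_3).

(** The lines of [s] meet [l] in distinct points, and P vanishes at each of them; so on [l] the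
    product of the corresponding forms divides P. *)
Lemma restrict_prod l s P : uniq s -> {in s, forall b, cross l b != 0} ->
  {in s &, forall a b, a != b -> dot a (cross l b) != 0} ->
  {in s, forall b, exists U V, P = lform b * U + lform l * V} ->
  exists U V, P = lprod s * U + lform l * V.
Proof.
elim: s => [|b s IHs] /= us sl sd sP.
  by exists P, 0; rewrite lprod_nil; ring.
have sub : {subset s <= b :: s} by move=> c; rewrite inE orbC => ->.
have /andP[bs us'] := us.
have [|||U [V PE]] := IHs us'.
- by move=> c /sub; apply: sl.
- by move=> c d /sub cs /sub ds; apply: sd.
- by move=> c /sub; apply: sP.
have [r rE r0] := lform2_retract (sl b (mem_head _ _)).
have rb : r (lform b) = 0 by apply/eqP; rewrite r0 dot_cross_r.
have rl : r (lform l) = 0 by apply/eqP; rewrite r0 dot_cross_l.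
have [U' [V' PE']] := sP b (mem_head _ _).
have /eqP := congr1 r PE; rewrite {1}PE' !rmorphD !rmorphM rb rl !mul0r !addr0.
rewrite eq_sym mulf_eq0 => /orP[/negPn/negP[]|/eqP rU].
  apply: retract_lprod_neq0 => c cs; rewrite r0; apply: sd; rewrite ?mem_head ?sub //.
  by apply: contraNneq bs => <-.
have [A [B UE]] := rE U; rewrite rU add0r in UE.
by exists B, (V + lprod s * A); rewrite PE UE lprod_cons; ring.
Qed.

Variables (gs hs : seq 'rV[F]_3) (p q b1 b2 : 'rV[F]_3).
Let l := cross p q.

Hypothesis nonpar : nonparallel (gs ++ hs).
Hypothesis g_p : {in gs, forall a, dot a p = 0}.
Hypothesis h_p : {in hs, forall a, dot a p != 0}.
Hypothesis g_q : {in gs, forall a, dot a q != 0}.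
Hypothesis two_gs : (1 < size gs)%N.
Hypothesis b1_h : b1 \in hs.
Hypothesis b2_h : b2 \in hs.
Hypothesis b12 : b1 != b2.
Hypothesis b1_q : dot b1 q = 0.
Hypothesis b2_q : dot b2 q = 0.

Let m := size gs.
Let e := size hs.
Let f := lprod (gs ++ hs).

Let fE : f = lprod gs * lprod hs. Proof. exact: lprod_cat. Qed.

Let subg : {subset gs <= gs ++ hs}.
Proof. by move=> a; rewrite mem_cat => ->. Qed.

Let subh : {subset hs <= gs ++ hs}.
Proof. by move=> a; rewrite mem_cat orbC => ->. Qed.

Let nonpar_g : nonparallel gs.
Proof.
apply: (nonparallel_sub _ subg nonpar); case: nonpar.
by rewrite cat_uniq => /andP[].
Qed.

Let nonpar_h : nonparallel hs.
Proof.
apply: (nonparallel_sub _ subh nonpar); case: nonpar.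
by rewrite cat_uniq => /and3P[].
Qed.

Let gh_cross : {in gs & hs, forall g b, cross b g != 0}.
Proof.
move=> g b gg bh; case: nonpar => _ _ np; apply: (np _ _ (subh bh) (subg gg)).
by apply: contraNneq (h_p bh) => ->; rewrite g_p.
Qed.

Let cross_b12 : cross b1 b2 != 0.
Proof. by case: nonpar_h => _ _; apply. Qed.

Let p_neq0 : p != 0.
Proof. by apply: contraNneq (h_p b1_h) => ->; rewrite dot0r. Qed.

Let two_lines : exists g1 g2, [/\ g1 \in gs, g2 \in gs & cross g1 g2 != 0].
Proof.
case: gs two_gs nonpar_g => [|g1 [|g2 gs']] //= _ [us _ np].
exists g1, g2; split; rewrite ?inE ?eqxx ?orbT //; apply: np;
  rewrite ?inE ?eqxx ?orbT //.
by move: us; rewrite /= inE negb_or => /andP[/andP[]].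
Qed.

Let size_f : (0 < size (gs ++ hs))%N.
Proof. by rewrite size_cat addn_gt0 (ltnW two_gs). Qed.

Let tangent_b12 v : tangent v hs -> tangent v [:: b1; b2].
Proof.
by apply: tangent_sub => b; rewrite !inE => /orP[/eqP->|/eqP->].
Qed.

(** If r < m and r < e, the determinant with E and p vanishes, so v = b E + c p with h dividing c.
    As deg(h) = e > r, the degree r part of c is 0, and a multiple of E that is a syzygy is 0. *)
Lemma AR_degree r v : AR f r v -> v != 0 -> (m <= r)%N \/ (e <= r)%N.
Proof.
move=> vAR v0; case: (leqP m r) => [|rm]; first by left.
case: (leqP e r) => [|re]; first by right.
have vt := AR_tangent nonpar vAR.
have vg := tangent_sub subg vt; have vh := tangent_sub subh vt.
have [hv /syzygyE vf] := vAR.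
have [K KE] := lprod_dvd_det3 nonpar_g (@tangent_euler _ _) vg (tangent_cst g_p).
have d0 : det3 E v (cst p) = 0.
  have := hpart_det3 r p v; rewrite (hrow_id hv) KE => <-.
  (* The determinant has degree r + 1 and is a multiple of g, of degree m. Only r + 1 = m leaves
     room for a cofactor, which is then constant and is killed by evaluation at [q]. *)
  move: rm; rewrite leq_eqVlt => /orP[/eqP mr|]; last first.
    exact: hpartM_lt (lprod_homog gs).
  have := hpartM 0 K (lprod_homog gs); rewrite -/m addn0 -mr => KE0.
  have [x xE] := homog0_const (hpartP 0 K).
  rewrite KE0 xE (_ : x = 0) ?mpolyC0 ?mulr0 //.
  apply: (det3_const0 cross_b12 b1_q b2_q g_q (tangent_b12 vh) (w := p)).
  by have := hpart_det3 r p v; rewrite (hrow_id hv) => <-; rewrite KE KE0 xE mulrC.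
have [g1 [g2 [g1g g2g g12]]] := two_lines.
have g1_0 : g1 != 0 by case: nonpar_g => _ /(_ g1 g1g).
have [b [c vE]] := det3_eq0 g12 p_neq0 g1_0 (g_p g1g) (g_p g2g) (vg _ g1g) d0.
have [c' cE] : divides (lprod hs) c.
  apply: lprod_dvd => // a ah; have [z az] := vh a ah.
  exists ((dot a p)^-1%:MP * (z - b)).
  have : c = (dot a p)^-1%:MP * (c * (dot a p)%:MP).
    by rewrite mulrCA -mpolyCM mulVf ?h_p // mulr1.
  move=> ->; have : dot (cst a) v = b * lform a + c * (dot a p)%:MP.
    by rewrite vE dotDr !dotZr dot_euler dot_cst.
  rewrite az => azE; suff -> : c * (dot a p)%:MP = lform a * (z - b).
    by rewrite mulrCA.
  by rewrite mulrBr azE [b * _]mulrC addrC addKr.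
have c0 : hpart r c = 0 by rewrite cE (hpartM_lt _ (lprod_homog hs)).
have [b' bE] := hrow_euler r b.
have {}vE : v = b' *: E.
  by rewrite -[LHS](hrow_id hv) {1}vE hrowD bE hrow_cst c0 scale0r addr0.
have b'0 : b' = 0.
  move: vf; rewrite vE dotZl dotC dot_grad_euler => /eqP.
  rewrite !mulf_eq0 -mpolyC_nat mpolyC_eq0 pnatr_eq0 eqn0Ngt size_f /=.
  by rewrite (negbTE (lprod_neq0 _)) ?orbF => [/eqP|]; case: nonpar.
by case/eqP: v0; rewrite vE b'0 scale0r.
Qed.

Let dvd_lprod s a : a \in s -> divides (lform a) (lprod s).
Proof. by move/perm_to_rem/lprod_perm ->; rewrite lprod_cons; exact: dvd_mulr. Qed.

(** The field h p is tangent to all lines: covectors of [gs] kill p, and h vanishes on the others.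
    It is not a multiple of E, as pairing with a line through p and then with [b1] shows. *)
Lemma AR_upper : AR_nonzero f e.
Proof.
pose v := lprod hs *: cst p.
have vt : tangent v (gs ++ hs).
  move=> a; rewrite mem_cat dotZr dot_cst => /orP[/g_p->|/dvd_lprod].
    by rewrite mpolyC0 mulr0; exists 0; rewrite mulr0.
  exact: divides_mulr.
have e0 : (0 < e)%N by rewrite /e; case: (hs) b1_h.
have vh : row_homog e.-1.+1 v.
  move=> i; rewrite prednK // /v entryZ -[e]addn0.
  exact: dhomogM (lprod_homog hs) (cst_homog p i).
have [K] := tangent_AR size_f vt vh; rewrite prednK // => vAR.
eexists; first exact: vAR.
have [g1 [_ [g1g _ _]]] := two_lines.
have g1_0 : g1 != 0 by case: nonpar_g => _ /(_ g1 g1g).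
move=> v0; have := dot0r (cst g1); rewrite -{1}v0 dotBr !dotZr dot_cst g_p //.
rewrite mpolyC0 mulr0 sub0r dot_euler => /eqP; rewrite oppr_eq0 mulf_eq0.
rewrite (negbTE (lform_neq0 g1_0)) orbF => /eqP K0.
move: v0; rewrite K0 scale0r subr0 => v0.
have := dot0r (cst b1); rewrite -{1}v0 dotZr dot_cst => /eqP.
rewrite mulf_eq0 mpolyC_eq0 (negbTE (h_p b1_h)) orbF; apply/negP.
by apply: lprod_neq0; case: nonpar_h.
Qed.

(** With [l] added to [gs], p becomes modular. On [l], the lines of [hs] other than [b2] meet at
    pairwise distinct points; [b2] is set aside because it shares [q] with [b1]. *)
Hypothesis modular_or_l : {in hs &, forall a b, a != b ->
  dot l (cross a b) = 0 \/ exists2 g, g \in gs & dot g (cross a b) = 0}.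
Hypothesis l_points : {in hs &, forall a b, a != b -> a != b2 -> b != b2 ->
  dot a (cross l b) != 0}.

Let l_p : dot l p = 0.
Proof. by rewrite dotC dot_cross_l. Qed.

Let cross_g_l : {in gs, forall g, cross g l != 0}.
Proof.
move=> g gg; rewrite crossC cross_cross dotC g_p // scale0r sub0r opprK.
by rewrite scaler_eq0 negb_or dotC g_q.
Qed.

Let cross_h_l : {in hs, forall b, cross b l != 0}.
Proof.
move=> b bh; have [g [_ [gg _ _]]] := two_lines.
apply/negP => /eqP/(congr1 (dot g)); rewrite crossC cross_cross dot0r.
rewrite dotNr dotBr !dotZr (g_p gg) mulr0 subr0 => /eqP.
by rewrite oppr_eq0 mulf_eq0 dotC (negbTE (h_p bh)) (negbTE (g_q gg)).
Qed.

Let l_neq0 : l != 0.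
Proof.
have [g [_ [gg _ _]]] := two_lines; apply: contraNneq (cross_g_l gg) => ->.
by apply/eqP/rowP3; rewrite !crossE !mxE !mulr0 subrr.
Qed.

Let nonpar_lg : nonparallel (l :: gs).
Proof.
have [ug n0 np] := nonpar_g.
have lg : l \notin gs.
  by apply/negP => /cross_g_l; rewrite crossvv eqxx.
split=> [|a|a b]; first by rewrite /= lg.
  by rewrite inE => /orP[/eqP->|/n0].
rewrite !inE => /orP[/eqP->|ag] /orP[/eqP->|bg]; rewrite ?eqxx // => ab.
- by rewrite crossC oppr_eq0 cross_g_l.
- exact: cross_g_l.
- exact: np.
Qed.

Let e' := size (rem b2 hs).

Let size_rem : e = e'.+1.
Proof. by rewrite /e /e' size_rem // prednK //; case: (hs) b2_h. Qed.

Let rem_sub : {subset rem b2 hs <= hs}.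
Proof. exact: mem_rem. Qed.

(** On [l], the field t is tangent to [l] and lies in the plane of E and p. Its coefficient along p
    vanishes at the e - 1 points where the lines of [hs] meet [l], so in degree m it is a constant
    times the product of [rem b2 hs], and it is 0 when m < e - 1. *)
Lemma plane_field : (m <= e')%N ->
  exists (t W : 'rV[S]_3) (A : S) (x k : F),
  [/\ k != 0, tangent t (gs ++ hs) /\ row_homog m t,
   det3 E t (cst p) = k%:MP * (lform l * lprod gs),
   t = A *: E + (x%:MP * lprod (rem b2 hs)) *: cst p + lform l *: W &
   (m < e')%N -> x = 0].
Proof.
move=> me; have [||||t0 [k [k0 tlg0 th0 dt0]]] :=
  modular_field p_neq0 nonpar_lg nonpar_h _ _ h_p.
- by [].
- by move=> a; rewrite inE => /orP[/eqP->|/g_p].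
- move=> a b; rewrite inE => /orP[/eqP->|ag] bh; first exact: cross_h_l.
  exact: gh_cross.
- move=> a b ah bh /(modular_or_l ah bh)[lab|[g gg gab]].
    by exists l; rewrite ?mem_head.
  by exists g; rewrite // inE gg orbT.
pose t := hrow m t0.
have tlg : tangent t (l :: gs) by apply: tangent_hrow.
have th : tangent t hs by apply: tangent_hrow.
have tg : tangent t gs by apply: tangent_sub tlg => a ag; rewrite inE ag orbT.
have dt : det3 E t (cst p) = k%:MP * (lform l * lprod gs).
  rewrite -hpart_det3 dt0 mulrC -[m.+1]addn0.
  rewrite (hpartM 0 _ (lprod_homog (l :: gs))) lprod_cons mulrC.
  by rewrite hpart_id // -[_%:MP]mulr1 mul_mpolyC rpredZ ?dhomog1.
have ht : row_homog m t by exact: hrow_homog.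
clearbody t; have [g [_ [gg _ _]]] := two_lines.
have [A gA] := tg g gg; have [B lB] := tlg l (mem_head _ _).
have [i gli] := row_neq0 (cross_g_l gg).
(* The vector n satisfies g(n) = 0 and l(n) = 1; it measures the part of t that leaves the plane of
   E and p, which is a multiple of l. *)
pose n := (cross g l ord0 i)^-1 *: - cross g (delta_mx ord0 i).
have gn : dot g n = 0 by rewrite dotZr dotNr dot_cross_l oppr0 mulr0.
have ln : dot l n = 1.
  by rewrite dotZr dotNr dot_cross_cycle (crossC l) dotNr opprK dotC dot_delta mulVf.
clearbody n; have [||C CE] := @killed2 _ g l p (t - A *: E - (lform l * (B - A)) *: cst n)
    (cross_g_l gg) p_neq0 (g_p gg) l_p.
- by rewrite !dotBr !dotZr dot_euler gA dot_cst gn mpolyC0; ring.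
- by rewrite !dotBr !dotZr dot_euler lB dot_cst ln mpolyC1; ring.
have tE : t = A *: E + C *: cst p + (lform l * (B - A)) *: cst n.
  by rewrite -CE -addrA subrK addrC subrK.
have [||||U [V CUV]] := @restrict_prod l (rem b2 hs) C.
- by apply: rem_uniq; case: nonpar_h.
- by move=> b /rem_sub bh; rewrite crossC oppr_eq0 cross_h_l.
- move=> a b ar br ab; apply: l_points; rewrite ?rem_sub //.
    by apply: contraTneq ar => ->; rewrite mem_rem_uniqF //; case: nonpar_h.
  by apply: contraTneq br => ->; rewrite mem_rem_uniqF //; case: nonpar_h.
- move=> b /rem_sub bh; have [D bD] := th b bh.
  exists ((dot b p)^-1%:MP * (D - A)).
  exists (- (dot b p)^-1%:MP * ((B - A) * (dot b n)%:MP)).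
  have bt : dot (cst b) t = A * lform b + C * (dot b p)%:MP
      + lform l * (B - A) * (dot b n)%:MP.
    by rewrite tE !dotDr !dotZr dot_euler !dot_cst.
  have -> : C = (dot b p)^-1%:MP * (C * (dot b p)%:MP).
    by rewrite mulrCA -mpolyCM mulVf ?h_p // mulr1.
  have -> : C * (dot b p)%:MP
      = dot (cst b) t - A * lform b - lform l * (B - A) * (dot b n)%:MP.
    by rewrite bt; ring.
  by rewrite bD; ring.
have [A' A'E] := hrow_euler m A.
have m0 : (0 < m)%N := ltnW two_gs.
have [x xE xm] : exists2 x : F, hpart m (lprod (rem b2 hs) * U)
    = x%:MP * lprod (rem b2 hs) & (m < e')%N -> x = 0.
  move: me; rewrite leq_eqVlt => /orP[/eqP me|me]; last first.
    by exists 0; rewrite // (hpartM_lt _ (lprod_homog _)) // mul0r.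
  have [x xE] := homog0_const (hpartP 0 U); exists x; last by rewrite me ltnn.
  by rewrite me -[e']addn0 (hpartM _ _ (lprod_homog _)) xE mulrC.
have [W tW] : exists W, t = A *: E + (lprod (rem b2 hs) * U) *: cst p + lform l *: W.
  by exists ((B - A) *: cst n + V *: cst p); rewrite tE; exact: regroup_scale.
exists t, (hrow m.-1 W), A', x, k.
split; [exact: k0 | by split; [exact: tangent_cat |] | exact: dt | | exact: xm].
transitivity (hrow m t); first by rewrite (hrow_id ht).
rewrite tW.
have Wm : hrow m (lform l *: W) = lform l *: hrow m.-1 W.
  suff WS j : j = m.-1.+1 -> hrow j (lform l *: W) = lform l *: hrow m.-1 W.
    exact: WS (esym (prednK m0)).
  by move=> ->; exact: hrow_scale (lform_homog l).
have Pm := hrow_cst m (lprod (rem b2 hs) * U) p; rewrite xE in Pm.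
by rewrite hrowD3; congr (_ + _ + _); [exact: A'E | exact: Pm | exact: Wm].
Qed.

Let cross_l_all : {in gs ++ hs, forall c, cross c l != 0}.
Proof. by move=> c; rewrite mem_cat => /orP[/cross_g_l|/cross_h_l]. Qed.

Let perm_hs : perm_eq hs (b2 :: rem b2 hs).
Proof. exact: perm_to_rem. Qed.

(** W is the quotient by l of t minus its part in the plane of E and p. It remains tangent to all
    lines except possibly [b2], as the subtracted multiple of p carries the other factors of h. If x
    were 0, W would also be tangent to [b2], and evaluation at [q] would force k = 0. *)
Lemma plane_quotient : (m <= e')%N ->
  exists (t W : 'rV[S]_3) (x k : F),
  [/\ (k != 0) /\ tangent t (gs ++ hs) /\ row_homog m t,
   det3 E t (cst p) = k%:MP * (lform l * lprod gs),
   tangent W (gs ++ rem b2 hs) /\ det3 E W (cst p) = k%:MP * lprod gs,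
   lform l * det3 E t W =
     - (x%:MP * lprod (rem b2 hs) * (k%:MP * (lform l * lprod gs))) &
   x != 0 /\ ~~ (m < e')%N].
Proof.
move=> /plane_field[t [W [A [x [k [k0 [tt ht] dt tE xm]]]]]].
have l0 := lform_neq0 l_neq0.
have WE : lform l *: W = t - A *: E - (x%:MP * lprod (rem b2 hs)) *: cst p.
  by rewrite tE -addrA -opprD [_ + lform l *: W]addrC addrK.
have tW c : c \in gs ++ hs ->
    divides (lform c) (x%:MP * lprod (rem b2 hs) * (dot c p)%:MP) ->
    divides (lform c) (dot (cst c) W).
  move=> cA cd; have c0 : c != 0 by case: nonpar => _ /(_ c cA).
  have : divides (lform c) (lform l * dot (cst c) W).
    rewrite -dotZr WE !dotBr !dotZr dot_euler dot_cst; apply: dividesB => //.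
    apply: dividesB; first exact: tt.
    by rewrite mulrC; exact: dvd_mulr.
  by move=> /(lform_prime c0)[/(lform_ndvd (cross_l_all cA))|].
have Wg : tangent W gs.
  by move=> c cg; apply: tW; [exact: subg | rewrite g_p // mulr0; exists 0; rewrite mulr0].
have Wr : tangent W (rem b2 hs).
  move=> c cr; apply: tW; first exact/subh/rem_sub.
  by rewrite mulrAC mulrC; apply/divides_mulr/dvd_lprod.
have dW : det3 E W (cst p) = k%:MP * lprod gs.
  apply: (mulfI l0); rewrite -det3Z WE !det3B !det3Z det3uu det3vv dt; ring.
have x0 : x != 0.
  apply: contraNneq k0 => x0; apply/eqP.
  apply: (det3_const0 cross_b12 b1_q b2_q g_q _ dW).
  apply: tangent_b12 => c ch; apply: tW; first exact: subh.
  by rewrite x0 mpolyC0 !mul0r; exists 0; rewrite mulr0.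
exists t, W, x, k; split.
- by [].
- exact: dt.
- by split; first exact: tangent_cat.
- rewrite -det3Zr WE !det3Br !det3Zr det3vv dt (det3_swap E E) det3uu.
  by ring.
- by split=> //; apply: contra x0 => /xm ->.
Qed.

Lemma size_hs_le : (e <= m.+1)%N.
Proof.
rewrite size_rem ltnS leqNgt; apply/negP => me.
have [t [W [x [k [_ _ _ _ []]]]]] := plane_quotient (ltnW me).
by rewrite me.
Qed.

(** Multiplying W by the form of [b2] restores tangency to that line. Together with t it gives two
    fields of degree m whose determinant with E has degree 2m + 1 = d and equals -(x k) f. *)
Lemma balanced_free : e = m.+1 -> AR_nonzero f m /\ free_arrangement f.
Proof.
rewrite size_rem => -[em]; have [|t [W [x [k]]]] := plane_quotient.
  by rewrite em.
move=> [[k0 [tt ht]] dt [tW dW] tWE [x0 _]].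
have l0 := lform_neq0 l_neq0.
have m0 : (0 < m)%N := ltnW two_gs.
pose u := hrow m (lform b2 *: W).
have tu : tangent u (gs ++ hs).
  apply: tangent_hrow => c; rewrite mem_cat dotZr (perm_mem perm_hs) inE orbCA.
  move=> /orP[/eqP->|cA]; first exact: dvd_mulr.
  by rewrite mulrC; apply/divides_mulr/tW; rewrite mem_cat.
have dtu : det3 E t u = (- (x * k))%:MP * f.
  have : det3 E t (lform b2 *: W) = (- (x * k))%:MP * f.
    apply: (mulfI l0); rewrite det3Zr mulrCA tWE fE (lprod_perm perm_hs) lprod_cons.
    by rewrite mpolyCN mpolyCM; ring.
  move=> /(congr1 (hpart (m + m).+1)); rewrite (hpart_det3_euler _ _ ht) => ->.
  have fh := lprod_homog (gs ++ hs).
  rewrite size_cat -/m -/e size_rem em addnS in fh.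
  by rewrite mul_mpolyC; apply: hpart_id; apply: rpredZ.
have hu : row_homog m u by exact: hrow_homog.
(* The degree is put in successor form because the correction by a multiple of E needs degree at
   least 1. *)
clearbody u; have m1 : m = m.-1.+1 by rewrite prednK.
rewrite m1 in ht hu.
have [A tAR] := tangent_AR size_f tt ht.
have [B uAR] := tangent_AR size_f tu hu.
rewrite -m1 in tAR uAR.
split.
  exists (t - A *: E); first exact: tAR.
  move=> t0; case/negP: k0; apply/eqP.
  have tAE : t = A *: E by apply/eqP; rewrite -subr_eq0 t0.
  move/eqP: dt; rewrite tAE det3Z det3uu mulr0 eq_sym mulf_eq0 mulf_eq0.
  rewrite (negbTE l0) mpolyC_eq0 /= (negbTE (lprod_neq0 _)) ?orbF => [/eqP //|].
  by case: nonpar_g.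
apply: (Saito nonpar size_f _ tAR uAR (k := - (x * k))).
  by rewrite oppr_eq0 mulf_neq0.
rewrite det3Br !det3Zr det3B det3Z det3uu !mulr0 subr0 dtu.
by rewrite det3_swap det3uu oppr0 mulr0 subr0.
Qed.

End NearPencil.

(** * The global Tjurina number *)

Local Open Scope fset_scope.
Local Open Scope nat_scope.

Section PointsAndLines.

Variable F : fieldType.
Implicit Types (p q L M H K : {vspace 'rV[F]_3}).

Lemma size_fset_filter (T : choiceType) (A : {fset T}) (P : pred T) :
  #|` [fset x in A | P x]| = count P A.
Proof.
rewrite -size_filter; apply: perm_size; apply: uniq_perm.
- exact: fset_uniq.
- by rewrite filter_uniq ?fset_uniq.
- by move=> x; rewrite mem_filter !inE /= andbC.
Qed.

Lemma point_neq_dim p q : is_point p -> is_point q -> p != q -> \dim (p + q) = 2.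
Proof.
move=> /eqP dp /eqP dq pq.
have d0 : \dim (p :&: q) = 0.
  apply/eqP; rewrite -leqn0 -ltnS ltnNge; apply: contraNN pq => d1.
  have e1 : (p :&: q)%VS = p by apply/eqP; rewrite eqEdim capvSl dp.
  have e2 : (p :&: q)%VS = q by apply/eqP; rewrite eqEdim capvSr dq.
  by rewrite -e1 {1}e2.
by have := dimv_sum_cap p q; rewrite dp dq d0 addn0.
Qed.

Lemma line_through p q L : is_point p -> is_point q -> p != q -> is_line L ->
  (p <= L)%VS -> (q <= L)%VS -> L = (p + q)%VS.
Proof.
move=> pp pq npq /eqP dL pL qL; apply/eqP; rewrite eq_sym eqEdim dL.
by rewrite (point_neq_dim pp pq npq) subv_add pL qL.
Qed.

Lemma line_cap_dim H K : is_line H -> is_line K -> H != K -> \dim (H :&: K) = 1.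
Proof.
move=> /eqP dH /eqP dK HK; apply/eqP; rewrite eqn_leq; apply/andP; split.
  rewrite -ltnS ltnNge; apply: contraNN HK => d2.
  have e1 : (H :&: K)%VS = H by apply/eqP; rewrite eqEdim capvSl dH.
  have e2 : (H :&: K)%VS = K by apply/eqP; rewrite eqEdim capvSr dK.
  by rewrite -e1 {1}e2.
have := dimv_sum_cap H K; rewrite dH dK.
have : \dim (H + K) <= 3 by rewrite (leq_trans (dimvS (subvf _))) // dimvf /dim /= mul1n.
by move: (\dim (H + K)) (\dim (H :&: K)) => [|[|[|[|]]]] // [].
Qed.

Lemma two_lines_point (A : {fset {vspace 'rV[F]_3}}) H K q : is_point q ->
  H \in A -> K \in A -> H != K -> (q <= H)%VS -> (q <= K)%VS ->
  intersection_point A q.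
Proof.
move=> qp HA KA HK qH qK; rewrite /intersection_point qp.
have sub : [fset H; K] `<=` [fset L in A | (q <= L)%VS].
  by apply/fsubsetP => L; rewrite in_fset2 => /orP[]/eqP->; rewrite !inE /= ?HA ?KA.
by have := fsubset_leq_card sub; rewrite cardfs2 HK.
Qed.

Lemma multiplicityE (A : {fset {vspace 'rV[F]_3}}) p :
  multiplicity A p = count (fun L => (p <= L)%VS) A.
Proof. exact: size_fset_filter. Qed.

Lemma size_away (A : {fset {vspace 'rV[F]_3}}) p :
  size [seq L <- A | ~~ (p <= L)%VS] = #|` A| - multiplicity A p.
Proof.
rewrite size_filter multiplicityE.
by rewrite -[#|` A|](count_predC (fun L => (p <= L)%VS)) addKn.
Qed.

End PointsAndLines.

Section Tjurina.

Variables (F : fieldType) (A : {fset {vspace 'rV[F]_3}}).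
Implicit Types (q L H K : {vspace 'rV[F]_3}).
Hypothesis lines : line_arrangement A.
Let pts := intersection_points A.

Let ptsE q : (q \in pts) = intersection_point A q.
Proof. exact: in_intersection_points. Qed.

Lemma tjurinaE : tjurina A = \sum_(q <- pts) (multiplicity A q - 1) ^ 2.
Proof.
pose G k := (k - 1) ^ 2.
transitivity (\sum_(2 <= k < #|` A|.+1)
    \sum_(q <- pts | multiplicity A q == k) G (multiplicity A q)).
  apply: eq_bigr => k _; rewrite /num_points size_fset_filter.
  under eq_bigr => q /eqP -> do [].
  by rewrite big_const_seq iter_addn_0 mulnC.
rewrite (exchange_big_dep xpredT) //= big_seq [RHS]big_seq.
apply: eq_bigr => q; rewrite ptsE => /andP[_ m2].
have md : multiplicity A q < #|` A|.+1.
  by rewrite ltnS multiplicityE count_size.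
rewrite (big_rem (multiplicity A q)) ?mem_index_iota ?m2 //= eqxx.
rewrite big_seq_cond big1 ?addn0 // => k.
rewrite mem_rem_uniq ?iota_uniq // !inE => /andP[/andP[nk _] /eqP kE].
by rewrite kE eqxx in nk.
Qed.

Let common H K := count (fun q => (q <= H)%VS && (q <= K)%VS) pts.

Let common1 H K : H \in A -> K \in A -> H != K -> common H K = 1.
Proof.
move=> HA KA HK; have d1 := line_cap_dim (lines HA) (lines KA) HK.
have hp : (H :&: K)%VS \in pts.
  rewrite ptsE; apply: (two_lines_point _ HA KA HK); rewrite ?capvSl ?capvSr //.
  exact/eqP.
rewrite /common (eq_in_count (a2 := pred1 (H :&: K)%VS)) => [|q].
  by rewrite count_uniq_mem ?fset_uniq // hp.
rewrite ptsE => /andP[/eqP dq _] /=; rewrite -subv_cap.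
by rewrite eqEdim dq d1 andbT.
Qed.

Variables p p' : {vspace 'rV[F]_3}.
Hypothesis p_pt : intersection_point A p.
Hypothesis p'_pt : intersection_point A p'.
Hypothesis p'_double : multiplicity A p' = 2.
Hypothesis p'_p : p' <> p.
Hypothesis near : forall q,
  intersection_point A q -> q <> p -> q <> p' -> (p + q)%VS \in A.
Hypothesis pp'_A : (p + p')%VS \notin A.

Let through := [seq L <- A | (p <= L)%VS].
Let away := [seq L <- A | ~~ (p <= L)%VS].
Let m := multiplicity A p.
Let e := size away.
Let ehs q := count (fun L => (q <= L)%VS) away.

Let size_through : size through = m.
Proof. by rewrite size_filter /m multiplicityE. Qed.

Let count_through q : is_point q -> q != p ->
  count (fun L => (q <= L)%VS) through = ((p + q)%VS \in A).
Proof.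
move=> qp nqp; have pp : is_point p by case/andP: p_pt.
rewrite count_filter -(count_uniq_mem _ (fset_uniq A)); apply: eq_in_count => L LA.
apply/andP/eqP => [[qL pL]|->]; last by rewrite addvSl addvSr.
by apply: line_through; rewrite // ?lines // eq_sym.
Qed.

Let multiplicity_split q :
  multiplicity A q = count (fun L => (q <= L)%VS) through + ehs q.
Proof.
rewrite multiplicityE /ehs -count_cat; apply/permP; rewrite perm_sym.
exact: (permEl (perm_filterC _ _)).
Qed.

(** Every intersection point other than p and p' lies on exactly one line through p, and p' lies on
    none. *)
Let e_through q : q \in pts -> q != p ->
  multiplicity A q = (q != p') + ehs q.
Proof.
rewrite ptsE => qpt nqp; rewrite multiplicity_split; congr addn.
rewrite count_through //; last by case/andP: qpt.
have [->|/eqP nqp'] := eqVneq q p'; first by rewrite (negbTE pp'_A).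
by rewrite near //; apply/eqP.
Qed.

Let e_p' : ehs p' = 2.
Proof.
have p'pts : p' \in pts by rewrite ptsE.
have nn : p' != p by apply/eqP.
by have := e_through p'pts nn; rewrite p'_double eqxx add0n => <-.
Qed.

Let e_p : ehs p = 0.
Proof.
apply/eqP; rewrite -leqn0 leqNgt -has_count; apply/hasPn => L.
by rewrite mem_filter => /andP[].
Qed.

(** For q other than p and p', the multiplicity minus 1 is [ehs q]. At p' the two squares are 1 and
    4, whence the correction 3. *)
Let term_eq q : q \in pts ->
  (multiplicity A q - 1) ^ 2 + 3 * (q == p') = (m - 1) ^ 2 * (q == p) + ehs q ^ 2.
Proof.
move=> qpt; have [->|nqp] := eqVneq q p.
  have /negbTE -> : p != p' by apply/eqP => /esym/p'_p.
  by rewrite e_p -/m !muln0 muln1 !addn0.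
rewrite muln0 (e_through qpt nqp).
by have [->|_] := eqVneq q p'; rewrite ?e_p' //= addKn muln0 addn0.
Qed.

Let sum_pred1 q (c : nat) : q \in pts -> \sum_(r <- pts) c * (r == q) = c.
Proof.
move=> qpt; rewrite -big_distrr /= -[RHS]muln1; congr (_ * _).
under eq_bigr => r _ do rewrite -[nat_of_bool _]/(if r == q then 1 else 0).
by rewrite -big_mkcond sum1_count count_uniq_mem ?fset_uniq // qpt.
Qed.

Let sum_common H (s : seq {vspace 'rV[F]_3}) :
  \sum_(q <- pts | (q <= H)%VS) count (fun L => (q <= L)%VS) s
  = \sum_(K <- s) common K H.
Proof.
under eq_bigr => q _ do rewrite -sum1_count big_mkcond /=.
rewrite exchange_big /=; apply: eq_bigr => K _.
rewrite /common -sum1_count -big_mkcondr /=.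
by apply: eq_bigl => q; rewrite andbC.
Qed.

(** This counts the points on H. Each line through p cuts H in one point, and every point of H
    except p' arises from exactly one such line. *)
Let common_self H : H \in away -> common H H = m + (p' <= H)%VS.
Proof.
move=> Haw; have [npH HA] : ~~ (p <= H)%VS /\ H \in A.
  by move: Haw; rewrite mem_filter => /andP[].
have e1 q : q \in pts -> (q <= H)%VS ->
    1 = count (fun L => (q <= L)%VS) through + (q == p').
  rewrite ptsE => qpt qH; have nqp : q != p by apply: contraNneq npH => <-.
  rewrite count_through //; last by case/andP: qpt.
  have [->|/eqP nqp'] := eqVneq q p'; first by rewrite (negbTE pp'_A).
  by rewrite near //; apply/eqP.
transitivity (\sum_(q <- pts | (q <= H)%VS)
    (count (fun L => (q <= L)%VS) through + (q == p'))).
  rewrite /common -sum1_count (eq_bigl (fun q => (q <= H)%VS)) => [|q]; last exact: andbb.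
  rewrite big_seq_cond [RHS]big_seq_cond.
  by apply: eq_bigr => q /andP[]; exact: e1.
rewrite big_split /= sum_common; congr (_ + _).
  rewrite -size_through -sum1_size big_seq [RHS]big_seq.
  apply: eq_bigr => K; rewrite mem_filter => /andP[pK KA].
  by apply: common1 => //; apply: contraNneq npH => <-.
rewrite -[RHS](sum_pred1 _ (q := p')) ?ptsE // big_mkcond.
apply: eq_bigr => q _; have [->|_] := eqVneq q p'.
  by case: ifP.
by rewrite muln0 if_same.
Qed.

(** Double counting of triples (q, H, K) with q on both lines H and K off p: for fixed H, each of
    the e - 1 other lines K contributes 1 and K = H contributes the number of points on H. The final
    2 counts the lines through p'. *)
Lemma sum_ehs : \sum_(q <- pts) ehs q ^ 2 = e * (e + m - 1) + 2.
Proof.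
transitivity (\sum_(q <- pts) \sum_(H <- away | (q <= H)%VS) ehs q).
  by apply: eq_bigr => q _; rewrite big_const_seq iter_addn_0 -mulnn.
rewrite (exchange_big_dep xpredT) //=.
under eq_bigr => H _ do rewrite sum_common.
transitivity (\sum_(H <- away) (e + m - 1 + (p' <= H)%VS)).
  rewrite big_seq [RHS]big_seq; apply: eq_bigr => H Haw.
  have ua : uniq away by rewrite filter_uniq ?fset_uniq.
  rewrite (big_rem H) //= common_self //.
  rewrite big_seq (eq_bigr (fun=> 1)) -?big_seq => [|K].
    rewrite sum1_size size_rem // -/e.
    have : 0 < e by rewrite /e; case: (away) Haw.
    by lia.
  rewrite mem_rem_uniq // !inE => /andP[KH Kaw].
  by apply: common1 => //; [move: Kaw | move: Haw]; rewrite mem_filter => /andP[].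
rewrite big_split /= big_const_seq count_predT iter_addn_0 mulnC -/e.
congr (_ + _); transitivity (ehs p'); last exact: e_p'.
rewrite /ehs -sum1_count [RHS]big_mkcond.
by apply: eq_bigr => H _; case: ifP.
Qed.

Lemma tjurina_near : tjurina A + 1 = (m - 1) ^ 2 + e * (e + m - 1).
Proof.
have : tjurina A + 3 = (m - 1) ^ 2 + (e * (e + m - 1) + 2).
  transitivity (\sum_(q <- pts) ((multiplicity A q - 1) ^ 2 + 3 * (q == p'))).
    by rewrite big_split /= sum_pred1 ?ptsE // tjurinaE.
  rewrite big_seq (eq_bigr _ (fun q => @term_eq q)) -big_seq big_split /=.
  by rewrite sum_pred1 ?ptsE // sum_ehs.
lia.
Qed.

End Tjurina.

(** * From lines to covectors *)

Local Open Scope ring_scope.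

Section Covectors.

Variable F : fieldType.
Implicit Types (L M p : {vspace 'rV[F]_3}) (l P : {mpoly F[3]}).

(** The coefficient vector of a linear form; it passes from the given equations of the lines to the
    covectors used above. *)
Definition covector l : 'rV[F]_3 := \row_(i < 3) l@_(U_(i)).

Lemma lform_covector l : l \is 1.-homog -> lform (covector l) = l.
Proof.
move=> hl; rewrite lformE; apply/mpolyP => k; rewrite raddf_sum /=.
have [/mdeg1P[j /eqP ->]|k1] := boolP (mdeg k == 1%N).
  rewrite (bigD1 j) //= mcoeffCM mcoeffX eqxx mulr1 mxE big1 ?addr0 // => i ij.
  rewrite mcoeffCM mcoeffX; case: eqP => [e|]; last by rewrite mulr0.
  by move/mnmP: e => /(_ i); rewrite !mnm1E eqxx eq_sym (negbTE ij).
rewrite (dhomog_nemf_coeff hl k1) big1 // => i _.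
rewrite mcoeffCM mcoeffX; case: eqP => [e|]; last by rewrite mulr0.
by rewrite -e mdeg1 in k1.
Qed.

Lemma mem_defined_line l L v : defines_line l L ->
  (v \in L) = (dot (covector l) v == 0).
Proof.
move=> [hl lL]; apply/idP/eqP.
  by move/lL; rewrite -{1}(lform_covector hl) meval_lform.
by move=> e; apply/lL; rewrite -(lform_covector hl) meval_lform.
Qed.

Lemma covector_neq0 l L : defines_line l L -> is_line L -> covector l != 0.
Proof.
move=> lL /eqP dL; apply/eqP => l0; suff e : L = fullv by rewrite e dimvf in dL.
by apply/vspaceP => v; rewrite memvf (mem_defined_line v lL) l0 dotC dot0r eqxx.
Qed.

Lemma defined_line_inj l k L M : defines_line l L -> defines_line k M ->
  is_line L -> is_line M -> cross (covector l) (covector k) = 0 -> L = M.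
Proof.
move=> lL kM iL iM /(parallel (covector_neq0 lL iL))[x kl].
have x0 : x != 0.
  by apply: contraNneq (covector_neq0 kM iM) => x0; rewrite kl x0 scale0r.
apply/vspaceP => v; rewrite (mem_defined_line v lL) (mem_defined_line v kM).
by rewrite kl dotZl mulf_eq0 (negbTE x0).
Qed.

Lemma point_span p : is_point p -> exists2 v, v != 0 & p = <[v]>%VS.
Proof.
move=> /eqP dp; have p0 : p != 0%VS by rewrite -dimv_eq0 dp.
exists (vpick p); first by rewrite vpick0.
apply/eqP; rewrite eq_sym eqEdim dim_vline vpick0 p0 dp -memvE memv_pick //.
Qed.

Lemma span_point (v : 'rV[F]_3) : v != 0 -> is_point <[v]>%VS.
Proof. by move=> v0; rewrite /is_point dim_vline v0. Qed.

End Covectors.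

(* The syzygies of [gs ++ hs], where [gs] is the pencil of the lines through   *)
(* [p], and [b1], [b2] are the lines through the exceptional double point [q]. *)
Lemma near_pencil_mdr (F : numFieldType) (gs hs : seq 'rV[F]_3)
    (p q b1 b2 : 'rV[F]_3) :
  nonparallel (gs ++ hs) ->
  {in gs, forall a, dot a p = 0} -> {in hs, forall a, dot a p != 0} ->
  {in gs, forall a, dot a q != 0} -> (1 < size gs)%N ->
  b1 \in hs -> b2 \in hs -> b1 != b2 -> dot b1 q = 0 -> dot b2 q = 0 ->
  {in hs &, forall a b, a != b -> dot (cross p q) (cross a b) = 0 \/
    exists2 g, g \in gs & dot g (cross a b) = 0} ->
  {in hs &, forall a b, a != b -> a != b2 -> b != b2 ->
    dot a (cross (cross p q) b) != 0} ->
  let f := lprod (gs ++ hs) in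
  [/\ (size hs <= (size gs).+1)%N,
      (size hs <= size gs)%N -> mdr f = size hs &
      size hs = (size gs).+1 -> mdr f = size gs /\ free_arrangement f].
Proof.
move=> np gp hp gq g1 b1h b2h b12 b1q b2q md lp f.
have [[v vf v0] fmin] := mdrP (lprod_homog (gs ++ hs)); rewrite -/f in vf fmin.
have lower : (size gs <= mdr f)%N \/ (size hs <= mdr f)%N.
  by apply: (AR_degree np gp hp gq g1 b1h b2h b12 b1q b2q vf); apply/eqP.
have up := fmin _ (AR_upper np gp hp g1 b1h).
split; first exact: size_hs_le np gp hp gq g1 b1h b2h b12 b1q b2q md lp.
  by move=> le; apply/eqP; rewrite eqn_leq up; case: lower => // /(leq_trans le).
move=> e.
have [/fmin upg free] := balanced_free np gp hp gq g1 b1h b2h b12 b1q b2q md lp e.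
split=> //; apply/eqP; rewrite eqn_leq upg; case: lower => //.
by rewrite e => /ltnW.
Qed.

(** * From nearly modular points of an arrangement to lists of covectors *)

Section Bridge.

Variables (F : numFieldType) (A : {fset {vspace 'rV[F]_3}}) (f : {mpoly F[3]}).
Variable p : {vspace 'rV[F]_3}.
Hypothesis lines : line_arrangement A.
Hypothesis fA : defining_equation A f.
Hypothesis near : nearly_modular A p.

Let m := multiplicity A p.
Let d := #|` A|.

Lemma multiplicity_le : (2 <= m <= d)%N.
Proof.
by case: near => /andP[_ ->] _ /=; rewrite /m multiplicityE count_size.
Qed.

(** The points p and p' become vectors v and w, and the lines become covectors. Two lines off p meet
    either at p', which lies on pp', or at a point joined to p by a line of the arrangement. *)
Lemma near_modular_mdr :
  [/\ (d - m <= m.+1)%N,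
      (d - m <= m)%N -> mdr f = (d - m)%N &
      (d - m = m.+1)%N -> mdr f = m /\ free_arrangement f].
Proof.
have [l lA ->] := fA; have [p_pt [p' [[p'_pt p'2 p'p] [md ppA onL]]]] := near.
have [pp m2] := andP p_pt; have [pp' _] := andP p'_pt.
have [v v0 pE] := point_span pp; have [w w0 p'E] := point_span pp'.
pose c L := covector (l L).
have mem L u : L \in A -> (u \in L) = (dot (c L) u == 0).
  by move=> LA; apply: mem_defined_line; exact: lA.
have pL L : L \in A -> (p <= L)%VS = (dot (c L) v == 0).
  by move=> LA; rewrite pE -memvE mem.
have p'L L : L \in A -> (p' <= L)%VS = (dot (c L) w == 0).
  by move=> LA; rewrite p'E -memvE mem.
pose G := [seq L <- A | (p <= L)%VS]; pose H := [seq L <- A | ~~ (p <= L)%VS].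
have GA L : L \in G -> L \in A by rewrite mem_filter => /andP[].
have HA L : L \in H -> L \in A by rewrite mem_filter => /andP[].
have sG : size G = m by rewrite size_filter /m multiplicityE.
have GH : perm_eq (G ++ H) A by exact: (permEl (perm_filterC _ _)).
have sH : size H = (d - m)%N by exact: size_away.
have inj : {in A &, injective c}.
  move=> L M LA MA e; apply: (defined_line_inj (lA _ LA) (lA _ MA));
    rewrite ?lines //.
  by rewrite -/(c L) e crossvv.
have fE : \prod_(L <- A) l L = lprod (map c G ++ map c H).
  rewrite -map_cat lprod.unlock big_map (perm_big _ GH).
  apply: eq_big_seq => L LA; rewrite lform_covector //.
  by case: (lA L LA).
have np : nonparallel (map c G ++ map c H).
  rewrite -map_cat; apply: (nonparallel_perm (s := map c A)).
    by rewrite perm_map // perm_sym.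
  split=> [|_ /mapP[L LA ->]|_ _ /mapP[L LA ->] /mapP[M MA ->]].
  - by rewrite map_inj_in_uniq ?fset_uniq.
  - exact: covector_neq0 (lA _ LA) (lines LA).
  apply: contraNneq => e; rewrite (defined_line_inj (lA _ LA) (lA _ MA)) ?lines //.
have npp : p != p' by apply/eqP => e; apply: p'p.
have p'G L : L \in G -> ~~ (p' <= L)%VS.
  move=> LG; apply: contraNN ppA => p'LL; have LA := GA _ LG.
  rewrite -(line_through pp pp' npp (lines LA)) //.
  by move: LG; rewrite mem_filter => /andP[].
have p'H L : L \in A -> (p' <= L)%VS -> L \in H.
  move=> LA p'LL; rewrite mem_filter LA andbT.
  by apply: contraL p'LL => pLL; apply: p'G; rewrite mem_filter pLL.
have [K1 [K2 [[K1A K2A K12 K1q K2q] Kq]]] : exists K1 K2, [/\ K1 \in A,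
    K2 \in A, K1 != K2, (p' <= K1)%VS & (p' <= K2)%VS] /\
    (forall L, L \in A -> (p' <= L)%VS -> L = K1 \/ L = K2).
  move: p'2; rewrite multiplicityE -size_filter.
  set s := filter _ _; have us : uniq s by rewrite filter_uniq ?fset_uniq.
  have ms L : (L \in s) = (p' <= L)%VS && (L \in A) by rewrite mem_filter.
  case: s us ms => [|K1 [|K2 [|]]] //= /andP[]; rewrite inE => K12 _ ms _.
  exists K1, K2; split; first split=> //.
  - by have := ms K1; rewrite inE eqxx => /esym/andP[].
  - by have := ms K2; rewrite !inE eqxx orbT => /esym/andP[].
  - by have := ms K1; rewrite inE eqxx => /esym/andP[].
  - by have := ms K2; rewrite !inE eqxx orbT => /esym/andP[].
  by move=> L LA p'LL; have := ms L; rewrite p'LL LA !inE => /orP[]/eqP; auto.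
have Hmem L : L \in H -> dot (c L) v != 0.
  by rewrite mem_filter => /andP[pLn LA]; rewrite -pL.
have two L M u : L \in A -> M \in A -> L != M -> u != 0 -> dot (c L) u = 0 ->
    dot (c M) u = 0 -> intersection_point A <[u]>%VS.
  move=> LA MA LM u0 Lu Mu.
  by apply: (two_lines_point (span_point u0) LA MA LM); rewrite -memvE mem ?Lu ?Mu.
have off L u : L \in H -> dot (c L) u = 0 -> <[u]>%VS <> p.
  move=> LH Lu e; move: (LH); rewrite mem_filter => /andP[/negP npL LA].
  by apply: npL; rewrite -e -memvE (mem _ _ LA) Lu eqxx.
have := @near_pencil_mdr F (map c G) (map c H) v w (c K1) (c K2) np.
rewrite /= -fE !size_map sG sH; apply.
- by move=> _ /mapP[L LG ->]; apply/eqP; rewrite -pL ?GA //; move: LG;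
    rewrite mem_filter => /andP[].
- by move=> _ /mapP[L LH ->]; exact: Hmem.
- by move=> _ /mapP[L LG ->]; rewrite -p'L ?GA // p'G.
- by [].
- by rewrite map_f // p'H.
- by rewrite map_f // p'H.
- by apply: contraNneq K12 => /inj ->.
- by apply/eqP; rewrite -p'L.
- by apply/eqP; rewrite -p'L.
- move=> _ _ /mapP[L LH ->] /mapP[M MH ->] cLM.
  have LM : L != M by apply: contraNneq cLM => ->.
  set u := cross (c L) (c M); have Lu : dot (c L) u = 0 := dot_cross_l _ _.
  have Mu : dot (c M) u = 0 := dot_cross_r _ _.
  have u0 : u != 0.
    by case: np => _ _; apply; rewrite ?mem_cat ?(map_f c LH) ?(map_f c MH) ?orbT.
  have ui := two L M u (HA _ LH) (HA _ MH) LM u0 Lu Mu.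
  have up := off L u LH Lu.
  have [e|/eqP up'] := eqVneq <[u]>%VS p'.
    left; have /vlineP[x ->] : u \in <[w]>%VS by rewrite -p'E -e memv_line.
    by rewrite dotZr dotC dot_cross_r mulr0.
  right; have gA := md _ ui up up'; exists (c (p + <[u]>)%VS).
    by rewrite map_f // mem_filter gA addvSl.
  by apply/eqP; rewrite -mem // memvE addvSr.
(* If L and M met on pp', the meeting point would be p or p'. It is not p, as M avoids p; at p' both
   lines would be [K1], since neither is [K2]. *)
move=> _ _ /mapP[L LH ->] /mapP[M MH ->] cLM cL2 cM2; apply/eqP => Lu.
have LM : L != M by apply: contraNneq cLM => ->.
have Mu : dot (c M) (cross (cross v w) (c M)) = 0 := dot_cross_r _ _.
set u := cross (cross v w) (c M) in Lu Mu.
have uE : u = dot v (c M) *: w - dot w (c M) *: v by rewrite /u cross_cross.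
have u0 : u != 0.
  apply/eqP => u0; move: npp; rewrite eq_sym pE p'E => /negP[].
  rewrite eqEdim !dim_vline v0 w0 andbT -memvE; apply/vlineP.
  exists (dot w (c M) / dot v (c M)).
  have vM : dot v (c M) != 0 by rewrite dotC Hmem.
  apply: (scalerI vM); rewrite scalerA mulrC divfK //; apply/eqP.
  by rewrite -subr_eq0 -uE u0.
have ui := two L M u (HA _ LH) (HA _ MH) LM u0 Lu Mu.
have [||] := onL _ ui; last 1 first.
- move=> e; have qK K : dot (c K) u = 0 -> K \in A -> (p' <= K)%VS.
    by move=> Ku KA; rewrite -e -memvE mem // Ku.
  have n2 K : c K != c K2 -> K <> K2 by move=> + e2; rewrite e2 eqxx.
  have [LK|] := Kq L (HA _ LH) (qK L Lu (HA _ LH)); last by move/(n2 _ cL2).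
  have [MK|] := Kq M (HA _ MH) (qK M Mu (HA _ MH)); last by move/(n2 _ cM2).
  by case/eqP: LM; rewrite LK MK.
- rewrite -memvE uE pE p'E memvB // memvZ //.
    by apply: (subvP (addvSr _ _)); exact: memv_line.
  by apply: (subvP (addvSl _ _)); exact: memv_line.
exact: off Mu.
Qed.

Lemma near_modular_nearly_free : mdr f = (d - m)%N -> nearly_free A f.
Proof.
move=> fm; have /andP[m2 md] := multiplicity_le.
have [p_pt [p' [[p'_pt p'2 p'p] [nr ppA _]]]] := near.
have := tjurina_near lines p_pt p'_pt p'2 p'p nr ppA.
rewrite size_away -/d -/m /nearly_free fm -/d; move: (tjurina A) => t.
(* Writing d = e + m and then m = k + 2 removes all truncated subtractions before passing to
   integers. *)
rewrite -(subnK md); move: (d - m)%N => e; rewrite addnK.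
case: m m2 => [|[|k]] // _ tE.
have {}tE : (t + 1 = k.+1 * k.+1 + e * (e + k.+1))%N.
  by rewrite tE subn1 addnS subn1 -mulnn.
have -> : t%:Z = k.+1%:Z * k.+1%:Z + e%:Z * (e%:Z + k.+1%:Z) - 1 by lia.
by rewrite PoszD !(intS, intS k); ring.
Qed.

End Bridge.

Lemma near_modular_cases (F : numFieldType) (A : {fset {vspace 'rV[F]_3}})
    (f : {mpoly F[3]}) (p : {vspace 'rV[F]_3}) :
  line_arrangement A -> defining_equation A f -> nearly_modular A p ->
  let d := #|` A| in
  let m := multiplicity A p in
  (d <= 2 * m)%N /\ mdr f = (d - m)%N /\ nearly_free A f \/
  [/\ d = (2 * m).+1, mdr f = m & free_arrangement f].
Proof.
move=> lA fA nA d m; have /andP[m2 md] := multiplicity_le nA.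
have [dm small big] := near_modular_mdr lA fA nA.
have [le|gt] := leqP (d - m)%N m.
  left; split; first by rewrite -/d -/m in md *; lia.
  by split; [exact: small | apply: near_modular_nearly_free (small le)].
have e : (d - m = m.+1)%N by rewrite -/d -/m in dm *; lia.
have [fm ff] := big e; right; split=> //.
by rewrite -/d -/m in md *; lia.
Qed.

Local Open Scope nat_scope.

Theorem theorem4p3 (R : realType) (A : {fset {vspace 'rV[R[i]%C]_3}})
    (f : {mpoly (R[i]%C)[3]}) (p : {vspace 'rV[R[i]%C]_3}) :
  line_arrangement A -> defining_equation A f ->
  nearly_supersolvable A -> nearly_modular A p ->
  let d := #|` A| in
  let m := multiplicity A p in
  let first_case := mdr f = d - m /\ nearly_free A f in
  let second_case :=
    exists d1, [/\ d = 2 * d1 + 1, mdr f = d1, m = d1 & free_arrangement f] in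
  [/\ first_case \/ second_case,
      first_case <-> d <= 2 * m &
      second_case <-> 2 * m = d - 1].
Proof.
move=> lA fA _ nA d m first_case second_case.
have /andP[m2 md] := multiplicity_le nA; rewrite -/d -/m in m2 md.
have [[dm [fm nf]]|[dm fm ff]] := near_modular_cases lA fA nA.
  rewrite -/d -/m in dm fm.
  have c1 : first_case by split.
  split; [by left | by split | split=> [[d1 [dE _ mE _]]|]].
    by exfalso; lia.
  by move=> e; exfalso; lia.
rewrite -/d -/m in dm fm.
have c2 : second_case by exists m; split=> //; lia.
split; [by right | split=> [[fm' _]|le] | split=> // _; lia].
  (* In the second range mdr(f) = m while d - m = m + 1, so the first case fails. *)
  by have e : (d - m = m)%N := etrans (esym fm') fm; exfalso; lia.
by exfalso; lia.
Qed.
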